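(* Let $p$ be an odd prime, $K$ a number field containing a primitive $p$-th root of unity $\zeta$, $R=\mathcal{O}_K$, and let $H=H_p$ be Nikshych's Hopf algebra over $K$. Assume that there is an ideal $I$ of $R$ such that $I^{2(p-1)}=(p)$, and let $J=I^{-1}=\{\alpha\in K:\alpha I\subseteq R\}$. Then the $R$-subalgebra $Y$ of $H$ generated by $e_0,e_1,g$, $J(u_a-e_0)$, $J(u_b-e_0)$, $J(v_a-e_1)$ and $J(v_b-e_1)$ is a Hopf order of $H$ over $R$. (Here $J(x)=\{\alpha x:\alpha\in J\}$.)
   Context: Nikshych's Hopf algebra $H=H_p$ over $K$: as a $K$-algebra it is generated by $e_0,e_1,u_a,u_b,v_a,v_b,g$ with defining relations $e_0+e_1=1$, $e_0e_1=e_1e_0=0$; $u_a^p=u_b^p=e_0$, $e_0u_a=u_a$, $e_0u_b=u_b$, $u_au_b=u_bu_a$; $v_a^p=v_b^p=e_1$, $e_1v_a=v_a$, $e_1v_b=v_b$, $v_av_b=\zeta v_bv_a$; $g^2=1$, $gu_a=u_bg$, $gu_b=u_ag$, $gv_a=v_ag$, $gv_b=v_bg$. Its Hopf structure is: $\Delta(u_a)=u_a\otimes u_a+v_a\otimes v_a$, $\Delta(u_b)=u_b\otimes u_b+v_b\otimes v_b^{p-1}$, $\Delta(v_a)=u_a\otimes v_a+v_a\otimes u_a$, $\Delta(v_b)=u_b\otimes v_b+v_b\otimes u_b^{p-1}$; $\varepsilon(u_a)=\varepsilon(u_b)=1$, $\varepsilon(v_a)=\varepsilon(v_b)=0$; $S(u_a)=u_a^{p-1}$,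 $S(u_b)=u_b^{p-1}$, $S(v_a)=v_a^{p-1}$, $S(v_b)=v_b$; $\varepsilon(g)=1$, $S(g)=g$, and $$\Delta(g)=\tfrac{1}{p^2}\sum_{i,j,k,l}\zeta^{kj-il}gu_a^iu_b^j\otimes gu_a^ku_b^l+\tfrac1p\sum_{k,l}\zeta^{-(k+l)k}gu_a^ku_b^l\otimes gv_a^{k+l}v_b^{k+l}+\tfrac1p\sum_{k,l}\zeta^{k(k+l)}gv_a^{k+l}v_b^{(p-1)(k+l)}\otimes gu_a^ku_b^l+\tfrac1p\sum_{k,l}gv_a^kv_b^l\otimes gv_a^{(p-1)l}v_b^k,$$ indices running from $0$ to $p-1$, with $u_a^0=u_b^0=e_0$, $v_a^0=v_b^0=e_1$. It has dimension $4p^2$. Hopf order of $H$ over $R=\mathcal{O}_K$: a finitely generated projective $R$-submodule $X\subset H$ such that the natural map $X\otimes_RK\to H$ is an isomorphism, $1_H\in X$, $XX\subseteq X$, $\Delta(X)\subseteq X\otimes_RX$ (viewed inside $H\otimes_KH$), $\varepsilon(X)\subseteq R$ and $S(X)\subseteq X$. *)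

(* Defs.v *)
From HB Require Import structures.
From mathcomp Require Import all_boot all_order all_algebra all_field.
From mathcomp Require Import boolp.
From mathcomp Require Import monalg.

Set Implicit Arguments.
Unset Strict Implicit.
Unset Printing Implicit Defensive.

Import Order.TTheory GRing.Theory Num.Theory.
Local Open Scope ring_scope.
Local Open Scope quotient_scope.

Notation bilin f := (bilinear_for *:%R *:%R f).

(* M (x)_R N is the type of formal sums of pairs (x, y), two sums being
   identified when no R-bilinear map out of M x N tells them apart. *)
Section Tensor.
Variables (R : comNzRingType) (M N : lmodType R).
Implicit Types (V : lmodType R) (s : seq (M * N)).

Definition evals (V : nmodType) (f : M -> N -> V) s :=
  \sum_(xy <- s) f xy.1 xy.2.

Definition tensor_rel s t :=
  `[< forall V (f : M -> N -> V), bilin f -> evals f s = evals f t >].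

Fact tensor_rel_refl : reflexive tensor_rel.
Proof. by move=> s; apply/asboolP. Qed.

Fact tensor_rel_sym : symmetric tensor_rel.
Proof. by move=> s t; apply/asboolP/asboolP => h V f /h. Qed.

Fact tensor_rel_trans : transitive tensor_rel.
Proof.
move=> t s u /asboolP st /asboolP tu; apply/asboolP => V f bf.
by rewrite st ?tu.
Qed.

Canonical tensor_equiv :=
  EquivRel tensor_rel tensor_rel_refl tensor_rel_sym tensor_rel_trans.

Definition tensor : Type := {eq_quot tensor_equiv}.
HB.instance Definition _ := Choice.on tensor.
HB.instance Definition _ := EqQuotient.on tensor.
Implicit Types (t u v : tensor).

(* The additive map induced by f, meaningful when f is bilinear: otherwise the
   value depends on the chosen representative. *)
Definition tlift (V : nmodType) (f : M -> N -> V) (t : tensor) : V :=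
  evals f (repr t).

Lemma tlift_pi V (f : M -> N -> V) s :
  bilin f -> tlift f (\pi_tensor s) = evals f s.
Proof.
move=> bf; rewrite /tlift.
have /eqquotP/asboolP h : repr (\pi_tensor s) = s %[mod tensor] by exact: reprK.
exact: h.
Qed.

Lemma tensor_ext t u :
  (forall V (f : M -> N -> V), bilin f -> tlift f t = tlift f u) -> t = u.
Proof.
by move=> h; rewrite -[t]reprK -[u]reprK; apply/eqquotP/asboolP.
Qed.

Definition tpure (x : M) (y : N) : tensor := \pi_tensor [:: (x, y)].
Definition tzero : tensor := \pi_tensor [::].
Definition tadd t u : tensor := \pi_tensor (repr t ++ repr u).
Definition topp t : tensor := \pi_tensor [seq (- xy.1, xy.2) | xy <- repr t].
Definition tscale (c : R) t : tensor :=
  \pi_tensor [seq (c *: xy.1, xy.2) | xy <- repr t].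

Section Lift.
Variables (V : lmodType R) (f : M -> N -> V) (bf : bilin f).

Fact bilin0l y : f 0 y = 0.
Proof.
have := bf.1 y 1 0 0; rewrite /= !scale1r addr0 => h.
by apply: (@addrI _ (f 0 y)); rewrite addr0 -h.
Qed.

Fact bilinDl y x x' : f (x + x') y = f x y + f x' y.
Proof. by have := bf.1 y 1 x x'; rewrite /= !scale1r. Qed.

Fact bilinZl y c x : f (c *: x) y = c *: f x y.
Proof. by have := bf.1 y c x 0; rewrite /= bilin0l !addr0. Qed.

Fact bilinNl y x : f (- x) y = - f x y.
Proof. by rewrite -scaleN1r bilinZl scaleN1r. Qed.

Fact bilin0r x : f x 0 = 0.
Proof.
have := bf.2 x 1 0 0; rewrite /= !scale1r addr0 => h.
by apply: (@addrI _ (f x 0)); rewrite addr0 -h.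
Qed.

Fact bilinDr x y y' : f x (y + y') = f x y + f x y'.
Proof. by have := bf.2 x 1 y y'; rewrite /= !scale1r. Qed.

Fact bilinZr x c y : f x (c *: y) = c *: f x y.
Proof. by have := bf.2 x c y 0; rewrite /= bilin0r !addr0. Qed.

Lemma tlift_pure x y : tlift f (tpure x y) = f x y.
Proof. by rewrite tlift_pi // /evals big_seq1. Qed.

Lemma tlift0 : tlift f tzero = 0.
Proof. by rewrite tlift_pi // /evals big_nil. Qed.

Lemma tliftD t u : tlift f (tadd t u) = tlift f t + tlift f u.
Proof. by rewrite tlift_pi // /evals big_cat. Qed.

Lemma tliftN t : tlift f (topp t) = - tlift f t.
Proof.
rewrite tlift_pi // /tlift /evals big_map -sumrN.
by apply: eq_bigr => xy _; rewrite bilinNl.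
Qed.

Lemma tliftZ c t : tlift f (tscale c t) = c *: tlift f t.
Proof.
rewrite tlift_pi // /tlift /evals big_map scaler_sumr.
by apply: eq_bigr => xy _; rewrite bilinZl.
Qed.
End Lift.

Fact taddA : associative tadd.
Proof.
by move=> t u v; apply: tensor_ext => V f bf; rewrite !tliftD ?addrA.
Qed.
Fact taddC : commutative tadd.
Proof.
move=> t u; apply: tensor_ext => V f bf.
by rewrite !tliftD ?(addrC (tlift f u)).
Qed.
Fact tadd0 : left_id tzero tadd.
Proof.
by move=> t; apply: tensor_ext => V f bf; rewrite tliftD ?tlift0 ?add0r.
Qed.
Fact taddN : left_inverse tzero topp tadd.
Proof.
move=> t; apply: tensor_ext => V f bf.
by rewrite tliftD ?tliftN ?tlift0 ?addNr.
Qed.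

HB.instance Definition _ :=
  GRing.isZmodule.Build tensor taddA taddC tadd0 taddN.

Fact tscaleA a b t : tscale a (tscale b t) = tscale (a * b) t.
Proof. by apply: tensor_ext => V f bf; rewrite !tliftZ ?scalerA. Qed.
Fact tscale1 : left_id 1 tscale.
Proof. by move=> t; apply: tensor_ext => V f bf; rewrite tliftZ ?scale1r. Qed.
Fact tscaleDr : right_distributive tscale +%R.
Proof.
move=> c t u; apply: tensor_ext => V f bf.
by rewrite tliftZ // !tliftD // !tliftZ // scalerDr.
Qed.
Fact tscaleDl t : {morph tscale^~ t : a b / a + b}.
Proof.
move=> a b; apply: tensor_ext => V f bf.
by rewrite tliftZ // tliftD // !tliftZ // scalerDl.
Qed.

HB.instance Definition _ := GRing.Zmodule_isLmodule.Build R tensor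
  tscaleA tscale1 tscaleDr tscaleDl.

Fact tlift_linear (V : lmodType R) (f : M -> N -> V) :
  bilin f -> linear (tlift f).
Proof. by move=> bf c t u; rewrite tliftD // tliftZ. Qed.

Fact tpure_bilin : bilin tpure.
Proof.
split=> [y|x] c z z'; apply: tensor_ext => V f bf;
  rewrite tliftD // tliftZ // !tlift_pure //=;
  by rewrite ?(bilinDl bf, bilinDr bf, bilinZl bf, bilinZr bf).
Qed.

Lemma tpureDl y : {morph (tpure^~ y) : x x' / x + x'}.
Proof. by move=> x x'; rewrite (bilinDl tpure_bilin). Qed.
Lemma tpureZl c x y : tpure (c *: x) y = c *: tpure x y.
Proof. exact: (bilinZl tpure_bilin). Qed.
Lemma tpureDr x : {morph tpure x : y y' / y + y'}.
Proof. by move=> y y'; rewrite (bilinDr tpure_bilin). Qed.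
Lemma tpureZr c x y : tpure x (c *: y) = c *: tpure x y.
Proof. exact: (bilinZr tpure_bilin). Qed.

Lemma tensor_sum_pure t : t = \sum_(xy <- repr t) tpure xy.1 xy.2.
Proof.
apply: tensor_ext => V f bf; rewrite {1}/tlift /evals.
elim: (repr t) => [|xy s IHs]; first by rewrite !big_nil tlift0.
by rewrite !big_cons tliftD // IHs tlift_pure.
Qed.
End Tensor.

Arguments tensor {R} (M N)%_type_scope.
Notation "M ⊗ N" := (tensor M N) (at level 40, left associativity) : type_scope.
Notation "x ⊗ y" := (tpure x y) (at level 40, left associativity) : ring_scope.

Lemma tensor_ind (R : comNzRingType) (M N : lmodType R) (P : M ⊗ N -> Prop) :
  P 0 -> (forall t u, P t -> P u -> P (t + u)) -> (forall x y, P (x ⊗ y)) ->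
  forall t, P t.
Proof.
by move=> P0 PD Pp t; rewrite (tensor_sum_pure t); elim/big_ind: _.
Qed.

(* Only a pzRingType: over a commutative ring the tensor product of two
   non-zero algebras may vanish. *)
Section TensorAlgebra.
Variables (R : comNzRingType) (A B : algType R).
Local Notation T := (A ⊗ B)%type.

Definition tmul (t u : T) : T :=
  tlift (fun x y => tlift (fun z w => (x * z) ⊗ (y * w)) u) t.

Fact tmul_inner_bilin x y :
  bilin (fun (z : A) (w : B) => ((x * z) ⊗ (y * w) : T)).
Proof.
split=> [w|z] c z1 z2 /=; rewrite mulrDr -scalerAr;
  by rewrite (tpureDl, tpureDr) (tpureZl, tpureZr).
Qed.

Fact tmul_outer_bilin u : bilin
  (fun (x : A) (y : B) => tlift (fun z w => (x * z) ⊗ (y * w) : T) u).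
Proof.
split=> [y|x] c x1 x2 /=; rewrite /tlift /evals scaler_sumr -big_split /=;
  apply: eq_bigr => -[z w] _ /=; rewrite mulrDl -scalerAl;
  by rewrite (tpureDl, tpureDr) (tpureZl, tpureZr).
Qed.

Lemma tmul_pure x y z w : tmul (x ⊗ y) (z ⊗ w) = (x * z) ⊗ (y * w).
Proof.
rewrite /tmul (tlift_pure (tmul_outer_bilin _)).
by rewrite (tlift_pure (tmul_inner_bilin _ _)).
Qed.

Fact tmulDl : left_distributive tmul +%R.
Proof. by move=> t u v; apply: (tliftD (tmul_outer_bilin v)). Qed.

Fact tmulDr : right_distributive tmul +%R.
Proof.
move=> v t u; rewrite /tmul {1 3 5}/tlift /evals -big_split /=.
by apply: eq_bigr => -[x y] _ /=; apply: (tliftD (tmul_inner_bilin x y)).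
Qed.

Fact tmul0l t : tmul 0 t = 0.
Proof. exact: (tlift0 (tmul_outer_bilin t)). Qed.

Fact tmul0r t : tmul t 0 = 0.
Proof. by apply: (@addrI _ (tmul t 0)); rewrite -tmulDr !addr0. Qed.

Fact tmulA : associative tmul.
Proof.
move=> t u v; elim/tensor_ind: t => [|t1 t2 IH1 IH2|x y].
- by rewrite !tmul0l.
- by rewrite !tmulDl IH1 IH2.
elim/tensor_ind: u => [|u1 u2 IH1 IH2|x' y'].
- by rewrite !(tmul0l, tmul0r).
- by rewrite !(tmulDl, tmulDr) IH1 IH2.
elim/tensor_ind: v => [|v1 v2 IH1 IH2|x'' y''].
- by rewrite !tmul0r.
- by rewrite !tmulDr IH1 IH2.
by rewrite !tmul_pure !mulrA.
Qed.

Fact tmul1l : left_id (1 ⊗ 1) tmul.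
Proof.
move=> t; elim/tensor_ind: t => [|t u IHt IHu|x y].
- by rewrite tmul0r.
- by rewrite tmulDr IHt IHu.
by rewrite tmul_pure !mul1r.
Qed.

Fact tmul1r : right_id (1 ⊗ 1) tmul.
Proof.
move=> t; elim/tensor_ind: t => [|t u IHt IHu|x y].
- by rewrite tmul0l.
- by rewrite tmulDl IHt IHu.
by rewrite tmul_pure !mulr1.
Qed.

HB.instance Definition _ := GRing.Zmodule_isPzRing.Build T
  tmulA tmul1l tmul1r tmulDl tmulDr.
End TensorAlgebra.

Definition tassoc (R : comNzRingType) (M N P : lmodType R) :
    (M ⊗ N) ⊗ P -> M ⊗ (N ⊗ P) :=
  tlift (fun t z => tlift (fun x y => x ⊗ (y ⊗ z)) t).

HB.mixin Record Algebra_isHopf (K : comNzRingType) H of GRing.Algebra K H := {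
  comul : {lrmorphism H -> tensor H H};
  counit : {lrmorphism H -> K^o};
  antipode : {linear H -> H};
  comulA : forall x,
    tassoc (tlift (fun a b => comul a ⊗ b) (comul x)) =
    tlift (fun a b => a ⊗ comul b) (comul x);
  counitl : forall x, tlift (fun a b => (counit a : K) *: b) (comul x) = x;
  counitr : forall x, tlift (fun a b => (counit b : K) *: a) (comul x) = x;
  antipodel : forall x,
    tlift (fun a b => antipode a * b) (comul x) = (counit x : K)%:A;
  antipoder : forall x,
    tlift (fun a b => a * antipode b) (comul x) = (counit x : K)%:A
}.

#[short(type="hopfAlgType")]
HB.structure Definition HopfAlgebra (K : comNzRingType) :=
  {H of GRing.Algebra K H & Algebra_isHopf K H}.

Definition integers_pred (K : fieldExtType rat) : {pred K} :=
  fun x => `[< integralOver (intr : int -> K) x >].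
Arguments integers_pred : clear implicits.

Fact integers_subring (K : fieldExtType rat) :
  subring_closed (integers_pred K).
Proof.
split=> [|x y /asboolP xO /asboolP yO|x y /asboolP xO /asboolP yO];
  apply/asboolP; [exact: integral1 | exact: integral_sub | exact: integral_mul].
Qed.

HB.instance Definition _ (K : fieldExtType rat) :=
  GRing.isSubringClosed.Build K (integers_pred K) (@integers_subring K).

Definition integers (K : fieldExtType rat) : Type :=
  {x : K | x \in integers_pred K}.

HB.instance Definition _ (K : fieldExtType rat) :=
  [isSub of integers K for @sval _ _].
HB.instance Definition _ (K : fieldExtType rat) :=
  [Choice of integers K by <:].
HB.instance Definition _ (K : fieldExtType rat) :=
  [SubChoice_isSubComNzRing of integers K by <:].

(* V with scalars restricted from K to its ring of integers *)
Definition restr (K : fieldExtType rat) (V : lmodType K) : Type := V.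

Section Restr.
Variables (K : fieldExtType rat) (V : lmodType K).
Local Notation R := (integers K).

HB.instance Definition _ := GRing.Zmodule.on (restr V).

Definition restr_scale (r : R) (x : restr V) : restr V := val r *: (x : V).

Fact restr_scaleA a b x : restr_scale a (restr_scale b x) = restr_scale (a * b) x.
Proof. by rewrite /restr_scale scalerA. Qed.
Fact restr_scale1 : left_id 1 restr_scale.
Proof. by move=> x; rewrite /restr_scale scale1r. Qed.
Fact restr_scaleDr : right_distributive restr_scale +%R.
Proof. by move=> c x y; rewrite /restr_scale scalerDr. Qed.
Fact restr_scaleDl x : {morph restr_scale^~ x : a b / a + b}.
Proof. by move=> a b; rewrite /restr_scale scalerDl. Qed.
HB.instance Definition _ := GRing.Zmodule_isLmodule.Build R (restr V)
  restr_scaleA restr_scale1 restr_scaleDr restr_scaleDl.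
End Restr.

Section RestrAlg.
Variables (K : fieldExtType rat) (A : algType K).
HB.instance Definition _ := GRing.NzRing.on (restr A).
Fact restr_scaleAl (r : integers K) (x y : restr A) : r *: (x * y) = r *: x * y.
Proof. exact: scalerAl. Qed.
Fact restr_scaleAr (r : integers K) (x y : restr A) : r *: (x * y) = x * (r *: y).
Proof. exact: scalerAr. Qed.
HB.instance Definition _ :=
  GRing.Lmodule_isLalgebra.Build (integers K) (restr A) restr_scaleAl.
HB.instance Definition _ :=
  GRing.Lalgebra_isAlgebra.Build (integers K) (restr A) restr_scaleAr.
End RestrAlg.

Section Modules.
Variables (R : comNzRingType).

Definition submodule (V : lmodType R) (X : submodClosed V) : Type :=
  {x : V | x \in X}.

HB.instance Definition _ (V : lmodType R) (X : submodClosed V) :=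
  [isSub of submodule X for @sval _ _].
HB.instance Definition _ (V : lmodType R) (X : submodClosed V) :=
  [Choice of submodule X by <:].
HB.instance Definition _ (V : lmodType R) (X : submodClosed V) :=
  [SubChoice_isSubLmodule of submodule X by <:].

Definition finitely_generated (M : lmodType R) : Prop :=
  exists s : seq M, forall x, exists c : 'I_(size s) -> R,
    x = \sum_i c i *: s`_i.

Definition projective (M : lmodType R) : Prop :=
  forall (N P : lmodType R) (f : {linear N -> P}) (g : {linear M -> P}),
    (forall y, exists x, f x = y) ->
    exists h : {linear M -> N}, forall x, f (h x) = g x.

Definition subalg_gen (A : lalgType R) (S : A -> Prop) : {pred A} :=
  fun x => `[< forall X : {pred A}, GRing.subalg_closed X ->
                 (forall s, S s -> s \in X) -> x \in X >].

Fact subalg_gen_closed (A : lalgType R) (S : A -> Prop) :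
  GRing.subalg_closed (subalg_gen S).
Proof.
split=> [|c x y /asboolP xX /asboolP yX|x y /asboolP xX /asboolP yX];
  apply/asboolP => X cX sX; have [X1 XZ XM] := cX.
- exact: X1.
- by apply: XZ; [apply: xX | apply: yX].
- by apply: XM; [apply: xX | apply: yX].
Qed.

HB.instance Definition _ (A : lalgType R) (S : A -> Prop) :=
  GRing.isSubalgClosed.Build R A (subalg_gen S) (subalg_gen_closed S).

Definition ideal_mul (I J : R -> Prop) (x : R) : Prop :=
  exists2 s : seq (R * R), (forall ab, ab \in s -> I ab.1 /\ J ab.2) &
    x = \sum_(ab <- s) ab.1 * ab.2.

(* the zeroth power is the whole ring *)
Definition ideal_exp (I : R -> Prop) (n : nat) : R -> Prop :=
  iter n (ideal_mul I) (fun=> True).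

Definition principal_ideal (a : R) (x : R) : Prop := exists b, x = b * a.
End Modules.

(* I^-1, as a subset of K *)
Definition inv_ideal (K : fieldExtType rat) (I : submodClosed (integers K)^o)
    (alpha : K) : Prop :=
  forall x, x \in I -> alpha * val (x : integers K) \in integers_pred K.

Section HopfOrder.
Variables (K : fieldExtType rat) (H : hopfAlgType K).
Variable X : submodClosed (restr H).
Local Notation R := (integers K).

(* the natural map X (x)_R K -> H *)
Definition base_change_map : submodule X ⊗ restr K^o -> H :=
  tlift (fun (x : submodule X) (k : restr K^o) => (k : K) *: (val x : H)).

(* X (x)_R X viewed inside H (x)_K H *)
Definition tensor_incl : submodule X ⊗ submodule X -> H ⊗ H :=
  tlift (fun x y : submodule X => (val x : H) ⊗ (val y : H)).

Record hopf_order : Prop := HopfOrder {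
  hopf_order_fg : finitely_generated (submodule X);
  hopf_order_proj : projective (submodule X);
  hopf_order_base_change : bijective base_change_map;
  hopf_order1 : (1 : H) \in X;
  hopf_orderM : forall x y : H, x \in X -> y \in X -> x * y \in X;
  hopf_order_comul : forall x : H, x \in X ->
    exists t, comul x = tensor_incl t;
  hopf_order_counit : forall x : H, x \in X ->
    (counit x : K) \in integers_pred K;
  hopf_order_antipode : forall x : H, x \in X -> antipode x \in X
}.
End HopfOrder.

Section Presentation.
Variables (K : fieldType) (G : choiceType).
Local Notation F := {malg K[{fmonom G}]}.

Definition free_gen (i : G) : F := << fmu i >>.

(* The two-sided ideal generated by the l - r, for (l, r) in rels. *)
Definition relation_ideal (rels : seq (F * F)) (w : F) : Prop :=
  exists2 s : seq (F * (F * F) * F), (forall t, t \in s -> t.1.2 \in rels) &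
    w = \sum_(t <- s) t.1.1 * (t.1.2.1 - t.1.2.2) * t.2.

Definition presented_by (A : algType K) (x : G -> A) (rels : seq (F * F)) :=
  exists pi : {lrmorphism F -> A},
    [/\ forall i, pi (free_gen i) = x i,
        forall a, exists w, pi w = a
      & forall w, pi w = 0 <-> relation_ideal rels w].
End Presentation.

Inductive nik_gen := E0 | E1 | Ua | Ub | Va | Vb | Gg.

Definition nik_code (i : nik_gen) : nat :=
  match i with
  | E0 => 0 | E1 => 1 | Ua => 2 | Ub => 3 | Va => 4 | Vb => 5 | Gg => 6
  end.
Definition nik_decode (n : nat) : nik_gen :=
  match n with
  | 0 => E0 | 1 => E1 | 2 => Ua | 3 => Ub | 4 => Va | 5 => Vb | _ => Gg
  end.
Fact nik_codeK : cancel nik_code nik_decode. Proof. by case. Qed.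
HB.instance Definition _ := Countable.copy nik_gen (can_type nik_codeK).

Section Nikshych.
Variables (K : fieldType) (p : nat) (zeta : K).

Definition nik_rels :
    seq ({malg K[{fmonom nik_gen}]} * {malg K[{fmonom nik_gen}]}) :=
  let e0 := free_gen K E0 in let e1 := free_gen K E1 in
  let ua := free_gen K Ua in let ub := free_gen K Ub in
  let va := free_gen K Va in let vb := free_gen K Vb in
  let g := free_gen K Gg in
  [:: (e0 + e1, 1); (e0 * e1, 0); (e1 * e0, 0);
      (ua ^+ p, e0); (ub ^+ p, e0); (e0 * ua, ua); (e0 * ub, ub);
      (ua * ub, ub * ua);
      (va ^+ p, e1); (vb ^+ p, e1); (e1 * va, va); (e1 * vb, vb);
      (va * vb, zeta *: (vb * va));
      (g ^+ 2, 1); (g * ua, ub * g); (g * ub, ua * g);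
      (g * va, va * g); (g * vb, vb * g)].

Variables (H : hopfAlgType K) (x : nik_gen -> H).
Local Notation e0 := (x E0).
Local Notation e1 := (x E1).
Local Notation ua := (x Ua).
Local Notation ub := (x Ub).
Local Notation va := (x Va).
Local Notation vb := (x Vb).
Local Notation g := (x Gg).

(* powers in the corners e0 H and e1 H, whose units are e0 and e1 *)
Definition corner_pow (e y : H) (n : nat) : H := if n is 0 then e else y ^+ n.

Definition gu (i j : nat) : H := g * corner_pow e0 ua i * corner_pow e0 ub j.
Definition gv (i j : nat) : H := g * corner_pow e1 va i * corner_pow e1 vb j.

Definition nik_comul_g : H ⊗ H :=
    (p ^ 2)%:R^-1 *: (\sum_(i < p) \sum_(j < p) \sum_(k < p) \sum_(l < p)
       zeta ^ ((k * j)%:Z - (i * l)%:Z) *: (gu i j ⊗ gu k l))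
  + p%:R^-1 *: (\sum_(k < p) \sum_(l < p)
       zeta ^ (- ((k + l) * k)%:Z) *: (gu k l ⊗ gv (k + l) (k + l)))
  + p%:R^-1 *: (\sum_(k < p) \sum_(l < p)
       zeta ^ (k * (k + l))%:Z *: (gv (k + l) ((p - 1) * (k + l)) ⊗ gu k l))
  + p%:R^-1 *: (\sum_(k < p) \sum_(l < p) gv k l ⊗ gv ((p - 1) * l) k).

(* comul and counit being algebra morphisms, and antipode an anti-morphism (a
   consequence of the Hopf axioms), their values on the remaining generators
   e0 = ua ^+ p and e1 = va ^+ p follow. *)
Record nikshych : Prop := Nikshych {
  nik_presented : presented_by x nik_rels;
  nik_comul_ua : comul ua = ua ⊗ ua + va ⊗ va;
  nik_comul_ub : comul ub = ub ⊗ ub + vb ⊗ vb ^+ (p - 1);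
  nik_comul_va : comul va = ua ⊗ va + va ⊗ ua;
  nik_comul_vb : comul vb = ub ⊗ vb + vb ⊗ ub ^+ (p - 1);
  nik_comul_gE : comul g = nik_comul_g;
  nik_counit_u : (counit ua : K) = 1 /\ (counit ub : K) = 1;
  nik_counit_v : (counit va : K) = 0 /\ (counit vb : K) = 0;
  nik_counit_g : (counit g : K) = 1;
  nik_antipode_u : antipode ua = ua ^+ (p - 1) /\ antipode ub = ub ^+ (p - 1);
  nik_antipode_va : antipode va = va ^+ (p - 1);
  nik_antipode_vb : antipode vb = vb;
  nik_antipode_g : antipode g = g
}.
End Nikshych.

Section OrderY.
Variables (K : fieldExtType rat) (H : hopfAlgType K) (x : nik_gen -> H).
Variable I : submodClosed (integers K)^o.

Definition order_gens (y : restr H) : Prop :=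
  [\/ y = x E0, y = x E1, y = x Gg
    | exists2 alpha : K, inv_ideal I alpha &
        [\/ y = alpha *: (x Ua - x E0), y = alpha *: (x Ub - x E0),
            y = alpha *: (x Va - x E1) | y = alpha *: (x Vb - x E1)]].

Definition orderY : {pred restr H} := subalg_gen order_gens.
HB.instance Definition _ := GRing.SubalgClosed.on orderY.
End OrderY.

(* Main.v *)
From HB Require Import structures.
Require Import Defs.
From mathcomp Require Import all_boot all_order all_algebra all_field.
From mathcomp Require Import boolp ring zify.
From mathcomp Require Import monalg.

Set Implicit Arguments.
Unset Strict Implicit.
Unset Printing Implicit Defensive.

Import Order.TTheory GRing.Theory Num.Theory.
Local Open Scope ring_scope.

(** Write pi = 1 - zeta, q = zeta^-1, R for the ring of integers of K and J
    for the inverse of I. As p is a unit times pi ^ (p - 1), the hypothesis on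
    I says that I is a square root of the ideal (pi); for every integer k,
    positive or not, the elements of I^k are then the a in K for which
    a^2 pi^-k is integral ([idpow], [inv_ideal_idpow], [idpow_inv_ideal]), and
    1 is in I^k I^-k ([unit_splitn]).

    The Newton polynomials P_m = (X - 1)(X - q) ... (X - q^(m-1)) carry the
    proof. As 1 - q^r is in I^2, the order Y contains J(a - q^r) whenever it
    contains J(a - 1), hence also J^m P_m(a) ([cor_newton_mem]).

    Module structure. P_p = X^p - 1 vanishes on the generators, so that the
    products P_m(ua) P_n(ub) g^eps and P_m(va) P_n(vb) g^eps with m, n < p
    span H. Give the product of degrees m and n the coefficient module
    J^(m+n). The resulting lattice contains 1 and is stable under left
    multiplication by the generators of Y: a term whose degree does not grow
    has a coefficient divisible by some q^m - 1, which is in I^2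
    ([orderY_weight_bounded]). So Y is this lattice. The products are
    linearly independent: the relations hold for explicit matrices, and matrix
    entries of these representations separate the products ([dual_basis]).
    Thus Y is a direct sum of invertible modules, hence finitely generated and
    projective ([orderY_dual_basis]), and it spans H over K.

    Hopf structure. Everything is multiplicative, so generators suffice; for
    the antipode this needs S(xy) = S(y)S(x), which holds in every Hopf algebra
    ([antipodeM]). The one serious point is the coproduct of g, whose formula
    has denominators p and p^2. It is made of Fourier kernels
    1/p sum_(k,l) zeta^(kl) a^k b^l. By the q-binomial formula of Gauss such a
    kernel equals sum_m P_m(a) P_m(b) / c_m, where c_m is a unit times pi^m;
    as pi^-m is in J^m J^m, each summand is in the order ([kernel_mem]).
    The kernel is the canonical element of a pairing for which the order
    generated by J(a - 1) is its own dual; this is why the square root of (pi)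
    is the right ideal. The four sums in the coproduct of g are g ⊗ g times
    products of kernels ([comul_g_term1], [comul_g_term2], [comul_g_term3],
    [comul_g_term4]). *)

(** * Powers of the square root of (1 - zeta) *)

Section Integers.
Variable K : fieldExtType rat.
Local Notation O := (integers_pred K).

Lemma integers_root (x : K) n : (0 < n)%N -> x ^+ n \in O -> x \in O.
Proof.
move=> n_gt0 /asboolP xnO; apply/asboolP.
apply: (@integral_root_monic _ _ (intr : {rmorphism int -> K}) x ('X^n - (x ^+ n)%:P)).
- exact: monicXnsubC.
- by rewrite rootE !hornerE subrr.
have/integral_poly h : forall i, integralOver (intr : int -> K) ('X^n - (x ^+ n)%:P)`_i.
  move=> i; rewrite coefB coefC coefXn; apply: integral_sub.
    exact: (integral_nat (intr : {rmorphism int -> K})).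
  by case: eqP => _ //; exact: (integral0 (intr : {rmorphism int -> K})).
exact: h.
Qed.

Lemma integers_val (r : integers K) : val r \in O. Proof. exact: valP. Qed.

Lemma intr_inj_ext : injective (intr : int -> K).
Proof.
move=> a b; rewrite -!(rmorph_int (in_alg K)) => /fmorph_inj.
exact: (@intr_inj rat).
Qed.

Lemma natf_neq0_ext n : (n%:R != 0 :> K) = (n != 0)%N.
Proof. by rewrite -(rmorph_nat (in_alg K)) fmorph_eq0 pnatr_eq0. Qed.

(** With l the leading coefficient and n the degree of f, l * k is a root of
    l^(n-1) f(X / l), which is monic with integer coefficients. *)
Lemma scaled_root_integer (k : K) (f : {poly int}) :
  f != 0 -> root (map_poly (intr : int -> K) f) k -> (lead_coef f)%:~R * k \in O.
Proof.
move=> f0 fk; set l := lead_coef f; set n := (size f).-1.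
have szf : size f = n.+1 by rewrite /n prednK // lt0n size_poly_eq0.
have szmap : size (map_poly (intr : int -> K) f) = n.+1.
  by rewrite size_map_inj_poly ?szf //; exact: intr_inj_ext.
have n_gt0 : (0 < n)%N.
  rewrite lt0n; apply/negP => /eqP n0; move: fk; rewrite n0 in szmap.
  have /size_poly1P[c c0 ->] : size (map_poly (intr : int -> K) f) == 1%N by rewrite szmap.
  by rewrite rootC (negPf c0).
pose r : {poly K} := \poly_(i < n) ((f`_i)%:~R * (l%:~R) ^+ (n.-1 - i)).
have szr : (size r < size ('X^n : {poly K}))%N by rewrite size_polyXn ltnS size_poly.
have intrO (z : int) : integralOver (intr : int -> K) z%:~R.
  exact: (integral_id (intr : {rmorphism int -> K})).
apply/asboolP.
apply: (@integral_root_monic _ _ (intr : {rmorphism int -> K}) _ ('X^n + r)).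
- by rewrite monicE lead_coefDl // lead_coefXn.
- rewrite rootE !hornerE horner_poly -?exprMn.
  move: fk; rewrite rootE horner_coef szmap big_ord_recr /= coef_map /= => /eqP fk.
  have fn : f`_n = l by rewrite /l lead_coefE.
  apply/eqP; transitivity (l%:~R ^+ n.-1 * (\sum_(i < n) (map_poly intr f)`_i * k ^+ i
     + l%:~R * k ^+ n)); last by rewrite -fn fk mulr0.
  rewrite mulrDr addrC mulrA -exprSr prednK // -exprMn; congr (_ + _).
  rewrite mulr_sumr; apply: eq_bigr => i _.
  rewrite coef_map exprMn /= !mulrA; congr (_ * _).
  rewrite -mulrA -exprD mulrC; congr (_ ^+ _ * _).
  by rewrite subnK // -ltnS prednK.
have/integral_poly h : forall i, integralOver (intr : int -> K) ('X^n + r)`_i.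
  move=> i; rewrite coefD coefXn coef_poly; apply: integral_add.
    exact: (integral_nat (intr : {rmorphism int -> K})).
  by case: ifP => _; [rewrite -rmorphXn -rmorphM; exact: intrO | exact: (intrO 0)].
exact: h.
Qed.

Lemma integers_denom (k : K) : exists2 d : integers K, val d != 0 & val d * k \in O.
Proof.
have [f ef] := polyOver1P (minPolyOver 1%AS k).
have [g [a a0 eg]] := rat_poly_scale f.
have g0 : g != 0.
  apply/eqP => g0; have := monic_neq0 (monic_minPoly 1%AS k).
  by rewrite ef eg g0 !rmorph0 scaler0 rmorph0 eqxx.
have gk : root (map_poly (intr : int -> K) g) k.
  have := root_minPoly 1%AS k; rewrite ef eg.
  rewrite map_polyZ /= rootZ; last by rewrite scaler_eq0 negb_or oner_neq0 invr_eq0 intr_eq0 a0.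
  rewrite -map_poly_comp; rewrite (eq_map_poly (g := intr)) // => i /=.
  by rewrite scaler_int.
have lO : (lead_coef g)%:~R \in O by rewrite rpred_int.
exists (exist (fun x => x \in O) _ lO : integers K) => /=; last exact: scaled_root_integer.
rewrite -(rmorph_int (in_alg K)) fmorph_eq0.
by rewrite intr_eq0 lead_coef_eq0.
Qed.

Variables (p : nat) (zeta : K).
Hypotheses (p_pr : prime p) (zetaP : p.-primitive_root zeta).
Let p_gt0 := prime_gt0 p_pr.
Local Notation pi := (1 - zeta).

Lemma unity_integer : zeta \in O.
Proof. by apply: (integers_root p_gt0); rewrite (prim_expr_order zetaP) rpred1. Qed.

Lemma subX_neq0 i : ~~ (p %| i)%N -> 1 - zeta ^+ i != 0.
Proof.
by apply: contra; rewrite subr_eq0 eq_sym (prim_order_dvd zetaP).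
Qed.

Lemma pi_neq0 : pi != 0.
Proof. by have := @subX_neq0 1; rewrite expr1; apply; rewrite gtnNdvd // prime_gt1. Qed.

Lemma quot_integer (w : K) n : w \in O -> (1 - w ^+ n) / (1 - w) \in O.
Proof.
move=> wO; have [->|nz] := eqVneq (1 - w) 0; first by rewrite invr0 mulr0 rpred0.
have -> : 1 - w ^+ n = (1 - w) * \sum_(i < n) w ^+ i.
  rewrite -[in LHS](expr1n _ n) subrXX; congr (_ * _).
  by apply: eq_bigr => i _; rewrite expr1n mul1r.
by rewrite mulrAC mulfV // mul1r rpred_sum // => i _; rewrite rpredX.
Qed.

(** zeta^i is a power of zeta^j, so the quotient is a geometric sum. *)
Lemma cyclotomic_unit i j : ~~ (p %| j)%N ->
  (1 - zeta ^+ i) / (1 - zeta ^+ j) \in O.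
Proof.
move=> pj.
have [k e] : exists k, zeta ^+ i = (zeta ^+ j) ^+ k.
  have cop : coprime j p by rewrite coprime_sym prime_coprime.
  have zj : p.-primitive_root (zeta ^+ j) by rewrite prim_root_exp_coprime.
  have zi1 : (zeta ^+ i) ^+ p = 1 by rewrite exprAC (prim_expr_order zetaP) expr1n.
  by have [k ->] := prim_rootP zj zi1; exists k.
by rewrite e; apply: quot_integer; rewrite rpredX ?unity_integer.
Qed.

(** Both sides are the value at 1 of (X^p - 1) / (X - 1). *)
Lemma prod_cyclotomic : \prod_(1 <= i < p) (1 - zeta ^+ i) = p%:R.
Proof.
have := factor_Xn_sub_1 zetaP; rewrite big_ltn // expr0 => e.
have {e}: \prod_(1 <= i < p) ('X - (zeta ^+ i)%:P) = \sum_(i < p) 'X^i :> {poly K}.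
  apply: (mulfI (x := 'X - 1%:P)); first by rewrite polyXsubC_eq0.
  by rewrite e subrX1.
move/(congr1 (horner^~ 1)); rewrite horner_prod horner_sum.
under eq_bigr do rewrite hornerXsubC.
under [X in _ = X -> _]eq_bigr do rewrite hornerXn expr1n.
by rewrite sumr_const card_ord.
Qed.

Lemma p_over_pi : p%:R / pi ^+ p.-1 \in O.
Proof.
rewrite -prod_cyclotomic -(card_ord p.-1) -[pi ^+ _]prodr_const -[p in index_iota _ p]prednK //.
rewrite big_add1 big_mkord -prodf_div rpred_prod // => i _.
rewrite -{2}[zeta]expr1; apply: cyclotomic_unit.
by rewrite gtnNdvd // prime_gt1.
Qed.

Lemma pi_over_p : pi ^+ p.-1 / p%:R \in O.
Proof.
rewrite -prod_cyclotomic -(card_ord p.-1) -[pi ^+ _]prodr_const -[p in index_iota _ p]prednK //.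
rewrite big_add1 big_mkord -prodf_div rpred_prod // => i _.
rewrite -{1}[zeta]expr1; apply: cyclotomic_unit.
by rewrite gtnNdvd // -[p in (_ < p)%N]prednK //= ltnS ltn_ord.
Qed.

(** The relation a \in I^k for an ideal I with I^2 = (1 - zeta), in a form that
    does not mention I and makes sense for every integer k. *)
Definition idpow (k : int) (a : K) : bool := a ^+ 2 * pi ^ (- k) \in O.

Lemma idpow_int a : idpow 0 a = (a \in O).
Proof.
rewrite /idpow oppr0 expr0z mulr1; apply/idP/idP => [|aO]; last by rewrite rpredX.
exact: integers_root.
Qed.

Lemma idpow0 k : idpow k 0.
Proof. by rewrite /idpow expr0n mul0r rpred0. Qed.

Lemma idpowM k l a b : idpow k a -> idpow l b -> idpow (k + l) (a * b).
Proof.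
rewrite /idpow => ha hb; rewrite opprD expfzDr ?pi_neq0 // exprMn mulrACA.
exact: rpredM.
Qed.

(** The cross term a b pi^-k is integral because its square is a product of
    two integers. *)
Lemma idpowD k a b : idpow k a -> idpow k b -> idpow k (a + b).
Proof.
rewrite /idpow => ha hb.
have hab : a * b * pi ^ (- k) \in O.
  apply: (@integers_root _ 2) => //.
  have -> : (a * b * pi ^ (- k)) ^+ 2 = (a ^+ 2 * pi ^ (- k)) * (b ^+ 2 * pi ^ (- k)).
    by rewrite !exprMn mulrACA.
  exact: rpredM.
by rewrite sqrrD !mulrDl !rpredD.
Qed.

Lemma idpow_mono k l a : k <= l -> idpow l a -> idpow k a.
Proof.
move=> kl ha; rewrite /idpow (_ : - k = l - k - l); last by rewrite addrAC subrr add0r.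
rewrite expfzDr ?pi_neq0 // mulrCA rpredM //.
rewrite -[l - k]gez0_abs ?subr_ge0 //.
by rewrite rpredX // rpredB ?rpred1 ?unity_integer.
Qed.

Lemma idpow_mull k r a : r \in O -> idpow k a -> idpow k (r * a).
Proof. by rewrite -idpow_int => r0 ka; rewrite -[k]add0r idpowM. Qed.

Lemma idpow_pi : idpow 2 pi.
Proof. by rewrite /idpow -exprnN mulfV ?expf_neq0 ?pi_neq0 ?rpred1. Qed.

Lemma idpow_piV : idpow (-2) pi^-1.
Proof. by rewrite /idpow opprK exprVn mulVf ?expf_neq0 ?pi_neq0 ?rpred1. Qed.

Lemma idpow_unity n : idpow 2 (zeta ^+ n - 1).
Proof.
rewrite -opprB -mulN1r idpow_mull ?rpredN1 // -[_ - _](mulfVK pi_neq0).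
by rewrite idpow_mull ?idpow_pi // quot_integer // unity_integer.
Qed.

(** Invertibility of I^k, by an explicit decomposition of 1 in I^k I^-k. *)
Definition unit_split (k : int) : Prop :=
  exists2 s : seq (K * K), (forall t, t \in s -> idpow k t.1 /\ idpow (- k) t.2) &
    \sum_(t <- s) t.1 * t.2 = 1.

Lemma unit_splitD k l : unit_split k -> unit_split l -> unit_split (k + l).
Proof.
move=> [s sP s1] [t tP t1].
exists [seq (a.1 * b.1, a.2 * b.2) | a <- s, b <- t].
  move=> _ /allpairsP[[a b] /= [/sP[a1 a2] /tP[b1 b2] ->]] /=.
  by rewrite opprD; split; apply: idpowM.
rewrite big_allpairs_dep /= -[RHS]mulr1 -{2}t1 -s1 mulr_suml.
by apply: eq_bigr => a _; rewrite mulr_sumr; apply: eq_bigr => b _; rewrite mulrACA.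
Qed.

Lemma unit_split0 : unit_split 0.
Proof.
exists [:: (1, 1)]; last by rewrite big_seq1 mulr1.
by move=> t; rewrite inE => /eqP -> /=; rewrite oppr0 idpow_int rpred1.
Qed.

Lemma unit_splitn : unit_split 1 -> forall n : nat, unit_split n%:Z.
Proof.
move=> s1; elim=> [|n IHn]; first exact: unit_split0.
by rewrite -addn1 PoszD; apply: unit_splitD.
Qed.

Section Ideal.
Variable I : submodClosed (integers K)^o.
Local Notation inI := (fun b : integers K => b \in I).
Hypothesis hI : forall a : integers K,
  ideal_exp inI (2 * (p - 1)) a <-> principal_ideal p%:R a.

Let N_gt0 : (0 < 2 * (p - 1))%N.
Proof. by rewrite muln_gt0 subn_gt0 prime_gt1. Qed.

Lemma val_sum_mul (s : seq (integers K * integers K)) :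
  val (\sum_(ab <- s) ab.1 * ab.2) = \sum_(ab <- s) val ab.1 * val ab.2.
Proof.
rewrite (rmorph_sum (val : {rmorphism integers K -> K})).
by apply: eq_bigr => ab _; rewrite rmorphM.
Qed.

Lemma ideal_exp_pow (a : integers K) n : a \in I -> ideal_exp inI n (a ^+ n).
Proof.
move=> aI; elim: n => //= n IHn; exists [:: (a, a ^+ n)].
  by move=> t; rewrite inE => /eqP->.
by rewrite big_seq1 exprS.
Qed.

Lemma inv_ideal_exp (alpha : K) (y : integers K) n :
  inv_ideal I alpha -> ideal_exp inI n y -> alpha ^+ n * val y \in O.
Proof.
move=> aJ; elim: n y => [|n IHn] y /=; first by rewrite mul1r integers_val.
case=> s sP ->; rewrite val_sum_mul mulr_sumr big_seq rpred_sum // => ab /sP[/= aI bI].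
by rewrite exprS mulrACA rpredM ?IHn ?aJ.
Qed.

Lemma val_nat n : val (n%:R : integers K) = n%:R.
Proof. by rewrite (rmorph_nat (val : {rmorphism integers K -> K})). Qed.

(** For alpha in J, alpha^(2(p-1)) multiplies p, an element of I^(2(p-1)), into
    R. As p is a unit times pi^(p-1), this bounds (alpha^2 pi)^(p-1), and R is
    integrally closed. *)
Lemma inv_ideal_idpow alpha : inv_ideal I alpha -> idpow (-1) alpha.
Proof.
move=> aJ; have /hI/(inv_ideal_exp aJ) : principal_ideal p%:R (p%:R : integers K).
  by exists 1; rewrite mul1r.
rewrite val_nat => h; apply: (@integers_root _ (p - 1)); first by rewrite subn_gt0 prime_gt1.
rewrite opprK expr1z exprMn -exprM subn1.
have -> : alpha ^+ (2 * p.-1) * pi ^+ p.-1 =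
    alpha ^+ (2 * p.-1) * p%:R * (pi ^+ p.-1 / p%:R).
  rewrite -!mulrA [_ / _]mulrC mulVKf // natf_neq0_ext -lt0n; exact: p_gt0.
by rewrite rpredM ?pi_over_p // -subn1.
Qed.

Lemma ideal_idpow (x : integers K) : x \in I -> idpow 1 (val x).
Proof.
move=> xI; have [b eb] := (hI _).1 (@ideal_exp_pow _ (2 * (p - 1)) xI).
apply: (@integers_root _ (p - 1)); first by rewrite subn_gt0 prime_gt1.
rewrite exprMn -exprM -(rmorphXn (val : {rmorphism integers K -> K})) eb rmorphM.
rewrite -[X in _ * (_ ^ X) ^+ _]/(-1%:Z) exprN1 exprVn subn1.
by rewrite rmorph_nat /= -mulrA rpredM ?integers_val ?p_over_pi.
Qed.

Lemma idpow_inv_ideal alpha : idpow (-1) alpha -> inv_ideal I alpha.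
Proof. by move=> ha x /ideal_idpow xI; rewrite -idpow_int -[0](addNr 1) idpowM. Qed.

(** Write p as a sum of products x w with x in I and w in I^(2(p-1)-1). Then
    1 is the sum of the x (w / p), and w / p multiplies I into R. *)
Lemma unit_split1 : unit_split 1.
Proof.
have pn0 : p%:R != 0 :> K by rewrite natf_neq0_ext -lt0n p_gt0.
have /hI : principal_ideal p%:R (p%:R : integers K) by exists 1; rewrite mul1r.
rewrite -(prednK N_gt0) /= => -[s sP /(congr1 val)]; rewrite val_nat => e.
exists [seq (val ab.1, val ab.2 / p%:R) | ab <- s].
  move=> _ /mapP[ab /sP[aI bI] ->] /=; split; first exact: ideal_idpow.
  apply: inv_ideal_idpow => y yI.
  have : ideal_exp inI (2 * (p - 1)) (y * ab.2).
    rewrite -(prednK N_gt0) /=; exists [:: (y, ab.2)]; last by rewrite big_seq1.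
    by move=> t; rewrite inE => /eqP->.
  move/hI => [b /(congr1 val)]; rewrite !rmorphM /= val_nat => eb.
  by rewrite mulrAC [val _ * _]mulrC eb mulfK ?integers_val.
rewrite big_map /=; under eq_bigr do rewrite mulrA.
rewrite -mulr_suml -val_sum_mul -e.
by rewrite mulfV.
Qed.

End Ideal.
End Integers.

(** * Newton interpolation at the powers of a root of unity *)

Section Newton.
Variables (K : fieldType) (p : nat) (q : K).
Hypotheses (qP : p.-primitive_root q) (p_neq0 : p%:R != 0 :> K).

Definition newton m : {poly K} := \prod_(r < m) ('X - (q ^+ r)%:P).
(** The constant c_m by which P_m must be divided to be 1 at q^m. *)
Definition newton_top m : K := (newton m).[q ^+ m].

Lemma newtonS m : newton m.+1 = newton m * ('X - (q ^+ m)%:P).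
Proof. by rewrite /newton big_ord_recr. Qed.

Lemma newton0 : newton 0 = 1.
Proof. by rewrite /newton big_ord0. Qed.

Lemma size_newton m : size (newton m) = m.+1.
Proof.
by rewrite /newton -(big_mkord xpredT (fun r => 'X - (q ^+ r)%:P)) size_prod_XsubC size_iota subn0.
Qed.

Lemma newton_full : newton p = 'X^p - 1.
Proof. by rewrite -(factor_Xn_sub_1 qP) big_mkord. Qed.

Lemma hornerN m x : (newton m).[x] = \prod_(r < m) (x - q ^+ r).
Proof. by rewrite horner_prod; apply: eq_bigr => r _; rewrite hornerXsubC. Qed.

Lemma newton_root a m : (a < m)%N -> (newton m).[q ^+ a] = 0.
Proof. by move=> am; rewrite hornerN (bigD1 (Ordinal am)) //= subrr mul0r. Qed.

Lemma prim_expf_inj i j : (i < p)%N -> (j < p)%N -> q ^+ i = q ^+ j -> i = j.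
Proof.
by move=> ip jp /eqP; rewrite (eq_prim_root_expr qP) !modn_small // => /eqP.
Qed.

Lemma newton_top_neq0 m : (m < p)%N -> newton_top m != 0.
Proof.
move=> mp; rewrite /newton_top hornerN; apply/prodf_neq0 => r _.
rewrite subr_eq0; apply/eqP => /(prim_expf_inj mp (ltn_trans (ltn_ord r) mp)) e.
by have := ltn_ord r; rewrite -e ltnn.
Qed.

Lemma newton_shift m x :
  (newton m.+1).[q * x] = (q * x - 1) * q ^+ m * (newton m).[x].
Proof.
rewrite !hornerN big_ord_recl expr0 -mulrA; congr (_ * _).
have -> : q ^+ m = \prod_(r < m) q by rewrite prodr_const card_ord.
rewrite -big_split /=; apply: eq_bigr => r _.
by rewrite exprS -mulrBr.
Qed.

(** The Gaussian binomial coefficient, as the value at q^n of the multiple of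
    P_m that is 1 at q^m. *)
Definition gauss_binom n m : K := (newton m).[q ^+ n] / newton_top m.

(** The q-Pascal rule. *)
Lemma gauss_binomS n i : (i.+1 < p)%N ->
  gauss_binom n.+1 i.+1 = gauss_binom n i + q ^+ i.+1 * gauss_binom n i.+1.
Proof.
move=> ip; have ci := newton_top_neq0 (ltnW ip); have := newton_top_neq0 ip.
rewrite /gauss_binom /newton_top !exprS !newton_shift newtonS hornerM hornerXsubC.
rewrite -/(newton_top i) !mulf_eq0 !negb_or => /andP[/andP[h1 h2] _].
field; do ?[apply/andP; split] => //.
Qed.

(** The binomial formula of Gauss: by the q-Pascal rule and the relation
    X P_m = P_(m+1) + q^m P_m. *)
Lemma newton_binomial n : (n < p)%N ->
  'X^n = \sum_(m < p) gauss_binom n m *: newton m.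
Proof.
have p0 : (0 < p)%N := prim_order_gt0 qP.
have gb0 k : gauss_binom k 0 = 1.
  by rewrite /gauss_binom /newton_top newton0 !hornerC divr1.
elim: n => [_|n IHn np].
  rewrite (bigD1 (Ordinal p0)) //= gb0 newton0 scale1r big1 ?addr0 ?expr0 //.
  by move=> i; rewrite -val_eqE /= -lt0n => i0; rewrite /gauss_binom newton_root // mul0r scale0r.
rewrite exprSr IHn ?(ltnW np) // mulr_suml.
have e (m : 'I_p) : gauss_binom n m *: newton m * 'X =
    gauss_binom n m *: newton m.+1 + (q ^+ m * gauss_binom n m) *: newton m.
  by move: (gauss_binom n m) => g; rewrite newtonS -!mul_polyC polyCM; ring.
rewrite (eq_bigr _ (fun m _ => e m)) big_split /=.
case: (p) p0 np (gauss_binomS) => // p' _ np gbS.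
rewrite big_ord_recr /= {2}/gauss_binom newton_root // mul0r scale0r addr0.
rewrite [X in _ + X]big_ord_recl [RHS]big_ord_recl /= !gb0 expr0 mulr1 addrCA; congr (_ + _).
rewrite -big_split /=; apply: eq_bigr => i _.
by rewrite gbS ?ltnS ?ltn_ord // -scalerDl.
Qed.

(** The polynomial of degree less than p that is 1 at q^k and 0 at the other
    powers of q, written as a Fourier sum. *)
Definition lagrange_node k : {poly K} := p%:R^-1 *: \sum_(l < p) q^-1 ^+ (k * l) *: 'X^l.

Lemma lagrange_nodeE k a : (k < p)%N -> (a < p)%N -> (lagrange_node k).[q ^+ a] = (k == a)%:R.
Proof.
move=> kp ap; rewrite /lagrange_node hornerZ horner_sum.
have q0 : q != 0 by rewrite (prim_root_eq0 qP) -lt0n (prim_order_gt0 qP).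
under eq_bigr => l _ do rewrite hornerZ hornerXn exprM -exprMn.
set z := q^-1 ^+ k * q ^+ a.
have [ka|ka] := eqVneq k a.
  have -> : z = 1 by rewrite /z ka exprVn mulVf ?expf_neq0.
  under eq_bigr do rewrite expr1n.
  by rewrite sumr_const card_ord mulVf.
have z1 : z - 1 != 0.
  rewrite subr_eq0; apply: contra ka => /eqP z1; apply/eqP/prim_expf_inj => //.
  by rewrite -[LHS]mulr1 -z1 /z exprVn mulVKf ?expf_neq0.
have zp : z ^+ p = 1.
  by rewrite /z exprMn exprVn exprVn -!exprM ![(_ * p)%N]mulnC !exprM (prim_expr_order qP) !expr1n invr1 mulr1.
rewrite [X in _ * X](_ : _ = 0) ?mulr0 //.
by apply: (mulfI z1); rewrite -subrX1 zp subrr mulr0.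
Qed.

Lemma eq_poly_roots (f g : {poly K}) : (size f <= p)%N -> (size g <= p)%N ->
  (forall a, (a < p)%N -> f.[q ^+ a] = g.[q ^+ a]) -> f = g.
Proof.
move=> sf sg fg; apply/eqP; rewrite -subr_eq0; apply/eqP.
apply: (roots_geq_poly_eq0 (rs := [seq q ^+ a | a <- iota 0 p])).
- apply/allP => x /mapP[a]; rewrite mem_iota add0n => /andP[_ ap] ->.
  by rewrite rootE !hornerE fg ?subrr.
- rewrite map_inj_in_uniq ?iota_uniq // => a b.
  by rewrite !mem_iota !add0n => /andP[_ ap] /andP[_ bp]; apply: prim_expf_inj.
- by rewrite size_map size_iota (leq_trans (size_polyD _ _)) // geq_max size_polyN sf.
Qed.

Lemma size_lagrange k : (size (lagrange_node k) <= p)%N.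
Proof.
rewrite /lagrange_node (leq_trans (size_scale_leq _ _)) //.
apply: (leq_trans (size_sum _ _ _)); apply/bigmax_leqP => l _.
by rewrite (leq_trans (size_scale_leq _ _)) // size_polyXn ltn_ord.
Qed.

(** Lagrange interpolation: P_m / c_m takes the value gauss_binom k m at q^k.
    With [newton_binomial] this says that the two families of coefficients are
    transposed to each other, which is the duality used in [kernel_mem]. *)
Lemma newton_lagrange m : (m < p)%N ->
  (newton_top m)^-1 *: newton m = \sum_(k < p) gauss_binom k m *: lagrange_node k.
Proof.
move=> mp; apply: eq_poly_roots.
- by rewrite (leq_trans (size_scale_leq _ _)) // size_newton.
- apply: (leq_trans (size_sum _ _ _)); apply/bigmax_leqP => k _.
  by rewrite (leq_trans (size_scale_leq _ _)) // size_lagrange.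
move=> a ap; rewrite hornerZ horner_sum (bigD1 (Ordinal ap)) //= big1 ?addr0.
  by rewrite hornerZ lagrange_nodeE // eqxx mulr1 mulrC.
move=> k; rewrite -val_eqE /= => ka.
by rewrite hornerZ lagrange_nodeE // (negPf ka) mulr0.
Qed.

End Newton.

Section Corner.
Variables (K : fieldType) (A : algType K) (E a : A).

(** The value of f at a in the corner of A cut out by the idempotent E: constant
    polynomials go to multiples of E. *)
Definition cor (f : {poly K}) : A := E * horner_alg a f.

Fact cor_linear : linear cor.
Proof. by move=> c f g; rewrite /cor linearP mulrDr /= mulr_algl -scalerAr. Qed.
HB.instance Definition _ := GRing.isLinear.Build K {poly K} A *:%R cor cor_linear.

Lemma corZ c f : cor (c *: f) = c *: cor f.
Proof. exact: linearZ. Qed.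

Lemma cor_sum (T : Type) (s : seq T) (P : pred T) (f : T -> {poly K}) :
  cor (\sum_(t <- s | P t) f t) = \sum_(t <- s | P t) cor (f t).
Proof. exact: linear_sum. Qed.

Hypotheses (EE : E * E = E) (Ea : E * a = a) (aE : a * E = a).

Lemma cor_comm f : GRing.comm E (horner_alg a f).
Proof.
elim/poly_ind: f => [|f c IHf]; first by rewrite rmorph0; apply: commr0.
rewrite rmorphD rmorphM /= horner_algX horner_algC.
apply: commrD; last by rewrite /GRing.comm mulr_algr mulr_algl.
by apply: commrM => //; rewrite /GRing.comm Ea aE.
Qed.

Lemma corM f g : cor (f * g) = cor f * cor g.
Proof.
rewrite /cor rmorphM -[RHS]mulrA [horner_alg a f * (E * _)]mulrA -(cor_comm f).
by rewrite !mulrA EE.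
Qed.

Lemma cor1 : cor 1 = E.
Proof. by rewrite /cor rmorph1 mulr1. Qed.

Lemma corX : cor 'X = a.
Proof. by rewrite /cor /= horner_algX Ea. Qed.

Lemma corC c : cor c%:P = c *: E.
Proof. by rewrite /cor /= horner_algC mulr_algr. Qed.

Lemma corXn n : cor 'X^n = E * a ^+ n.
Proof. by rewrite /cor rmorphXn /= horner_algX. Qed.

Lemma corXsubC c : cor ('X - c%:P) = a - c *: E.
Proof. by rewrite linearB /= corC corX. Qed.

End Corner.

Section Order.
Variables (K : fieldExtType rat) (p : nat) (zeta : K).
Hypotheses (p_pr : prime p) (zetaP : p.-primitive_root zeta).
Local Notation O := (integers_pred K).
Local Notation idpow := (idpow zeta).

Section Root.
Variable q : K.
Hypothesis qP : p.-primitive_root q.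

Lemma prim_pow : exists k, q = zeta ^+ k.
Proof. by have [k ->] := prim_rootP zetaP (prim_expr_order qP); exists k. Qed.

Lemma idpow_rootB m : idpow 2 (q ^+ m - 1).
Proof. by have [k ->] := prim_pow; rewrite -exprM; apply: (idpow_unity p_pr zetaP). Qed.

Lemma root_integer : q \in O.
Proof. by have [k ->] := prim_pow; rewrite rpredX // (unity_integer p_pr zetaP). Qed.

(** q^m - q^r is associated with 1 - zeta. *)
Lemma idpow_rootBV r m : (r < m)%N -> (m < p)%N -> idpow (- 2) (q ^+ m - q ^+ r)^-1.
Proof.
move=> rm mp; have mr : ~~ (p %| m - r)%N.
  by rewrite gtnNdvd ?subn_gt0 // (leq_ltn_trans (leq_subr _ _)).
have [k qk] := prim_pow; have kp : ~~ (p %| k)%N.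
  have := prim_root_exp_coprime k zetaP; rewrite -qk qP => /esym.
  by rewrite coprime_sym prime_coprime.
have -> : q ^+ m - q ^+ r = - (q ^+ r * (1 - zeta ^+ (k * (m - r)))).
  by rewrite mulrBr exprM -qk -exprD subnKC ?(ltnW rm) // mulr1 opprB.
have qr : (q ^+ r)^-1 \in O.
  have q1 : q ^+ r * q ^+ (p.-1 * r) = 1.
    by rewrite -exprD -mulSn prednK ?prime_gt0 // exprM (prim_expr_order qP) expr1n.
  have q0 : q ^+ r != 0 by apply: contra_eq_neq q1 => ->; rewrite mul0r eq_sym oner_neq0.
  by rewrite -[_^-1]mulr1 -q1 mulKf // rpredX // root_integer.
set w := 1 - zeta ^+ _; have pi0 := pi_neq0 p_pr zetaP.
have -> : (- (q ^+ r * w))^-1 = - 1 * (q ^+ r)^-1 * ((1 - zeta) / w * (1 - zeta)^-1).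
  by rewrite invrN invfM mulN1r mulNr [(1 - zeta) / w]mulrC -[w^-1 * _ * _]mulrA mulfV // mulr1.
rewrite (idpow_mull p_pr zetaP) //; first by rewrite rpredM ?rpredN1.
rewrite (idpow_mull p_pr zetaP) ?(idpow_piV p_pr zetaP) // /w -{1}[zeta]expr1.
apply: (cyclotomic_unit p_pr zetaP).
by rewrite Euclid_dvdM // negb_or kp mr.
Qed.

Lemma idpow_newton_topV m : (m < p)%N -> idpow (- 2 * m%:Z) (newton_top q m)^-1.
Proof.
move=> mp; rewrite /newton_top hornerN -prodfV.
have h n : (n <= m)%N -> idpow (- 2 * n%:Z) (\prod_(r < n) (q ^+ m - q ^+ r)^-1).
  elim: n => [|n IHn] nm; first by rewrite big_ord0 mulr0 idpow_int rpred1.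
  rewrite big_ord_recr /= intS mulrDr mulr1 addrC.
  apply: (idpowM p_pr zetaP); first by rewrite IHn // ltnW.
  exact: idpow_rootBV.
exact: h.
Qed.

Variable A : algType K.

Record integral_algebra (S : A -> Prop) : Prop := IntegralAlgebra {
  int_alg1 : S 1;
  int_algD : forall x y, S x -> S y -> S (x + y);
  int_algM : forall x y, S x -> S y -> S (x * y);
  int_algZ : forall r x, r \in O -> S x -> S (r *: x) }.

Variable S : A -> Prop.
Hypothesis SA : integral_algebra S.

Lemma int_algB x y : S x -> S y -> S (x - y).
Proof.
by move=> Sx Sy; apply: (int_algD SA) => //; rewrite -scaleN1r; apply: (int_algZ SA); rewrite ?rpredN1.
Qed.

Lemma int_alg0 : S 0.
Proof. by rewrite -(scale0r 1); apply: (int_algZ SA); rewrite ?rpred0 //; apply: (int_alg1 SA). Qed.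

Lemma int_alg_sum (T : Type) (s : seq T) (P : pred T) (f : T -> A) :
  (forall t, P t -> S (f t)) -> S (\sum_(t <- s | P t) f t).
Proof. by move=> h; elim/big_ind: _ => //; [apply: int_alg0|apply: (int_algD SA)]. Qed.

Lemma int_algX x n : S x -> S (x ^+ n).
Proof.
move=> Sx; elim: n => [|n IHn]; first exact: int_alg1.
by rewrite exprS; apply: (int_algM SA).
Qed.

(** The condition J(a - E) \subset S, which the generators of Y satisfy. *)
Definition close (E a : A) : Prop := forall b, idpow (-1) b -> S (b *: (a - E)).

Lemma close_mem E a : S E -> close E a -> S a.
Proof.
move=> SE aE; rewrite -(subrK E a); apply: (int_algD SA) => //.
rewrite -(scale1r (a - E)); apply: aE.
by apply: (idpow_mono p_pr zetaP (l := 0)) => //; rewrite idpow_int ?rpred1.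
Qed.

(** From a b - E = (a - E) b + (b - E). *)
Lemma closeM E a b : E * b = b -> S E -> close E a -> close E b -> close E (a * b).
Proof.
move=> Eb SE na nb c hc.
have -> : c *: (a * b - E) = c *: (a - E) * b + c *: (b - E).
  by rewrite -scalerAl -scalerDr mulrBl Eb addrA subrK.
apply: (int_algD SA); last exact: nb.
by apply: (int_algM SA); [exact: na|exact: (close_mem SE nb)].
Qed.

Lemma close_refl E : close E E.
Proof. by move=> b _; rewrite subrr scaler0; apply: int_alg0. Qed.

Lemma closeX E a n : E * a = a -> S E -> close E a -> close E (E * a ^+ n).
Proof.
move=> Ea SE na; elim: n => [|n IHn]; first by rewrite mulr1; apply: close_refl.
by rewrite exprSr mulrA; apply: closeM.
Qed.

Section Newton.
Hypothesis split1 : unit_split zeta 1.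

(** An element of J^m is a sum of products of m elements of J; these can be
    distributed over the m factors of P_m(a), each of the form
    a - q^r E = (a - E) - (q^r - 1) E with q^r - 1 in I^2. *)
Lemma cor_newton_mem E a m c : E * E = E -> E * a = a -> a * E = a ->
  S E -> close E a -> idpow (- m%:Z) c -> S (c *: cor E a (newton q m)).
Proof.
move=> EE Ea aE SE na; elim: m c => [|m IHm] c hc.
  by rewrite newton0 cor1; apply: (int_algZ SA) => //; rewrite -(idpow_int zeta).
have [s sP s1] := split1.
rewrite newtonS corM // corXsubC // -[c]mulr1 -s1 mulr_sumr scaler_suml big_seq.
apply: int_alg_sum => t /sP[t1 t2].
rewrite mulrA -scalerA scalerAr scalerAl; apply: (int_algM SA).
  apply: IHm; rewrite -[- m%:Z](_ : - m.+1%:Z + 1 = _); last by rewrite intS opprD addrC addNKr.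
  exact: (idpowM p_pr zetaP).
rewrite (_ : a - _ = (a - E) - (q ^+ m - 1) *: E); last first.
  by rewrite scalerBl scale1r opprB addrA subrK.
rewrite scalerBr scalerA; apply: int_algB; first exact: na.
apply: (int_algZ SA) => //; rewrite -(idpow_int zeta).
apply: (idpow_mono p_pr zetaP (l := -1 + 2)) => //.
by apply: (idpowM p_pr zetaP) => //; apply: idpow_rootB.
Qed.

(** Expanding a^k by [newton_binomial] and summing over k by [newton_lagrange]
    turns the kernel into the sum of the P_m(a) P_m(b) / c_m. Here c_m^-1 is in
    J^(2m), so it can be shared between P_m(a) and P_m(b). *)
Lemma kernel_mem E F a b : E * E = E -> E * a = a -> a * E = a ->
  F * F = F -> F * b = b -> b * F = b -> S E -> S F -> close E a -> close F b ->
  S (p%:R^-1 *: \sum_(k < p) \sum_(l < p)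
       q^-1 ^+ (k * l) *: ((E * a ^+ k) * (F * b ^+ l))).
Proof.
move=> EE Ea aE FF Fb bF SE SF na nb.
have pn0 : p%:R != 0 :> K by rewrite natf_neq0_ext -lt0n prime_gt0.
have -> : p%:R^-1 *: \sum_(k < p) \sum_(l < p)
       q^-1 ^+ (k * l) *: ((E * a ^+ k) * (F * b ^+ l)) =
   \sum_(m < p) cor E a (newton q m) * cor F b ((newton_top q m)^-1 *: newton q m).
  transitivity (\sum_(k < p) cor E a 'X^k * cor F b (lagrange_node p q k)).
    rewrite scaler_sumr; apply: eq_bigr => k _.
    rewrite /lagrange_node corZ cor_sum -scalerAr mulr_sumr; congr (_ *: _).
    by apply: eq_bigr => l _; rewrite corZ -scalerAr !corXn.
  under eq_bigr => k _.
    rewrite (newton_binomial qP (ltn_ord k)) cor_sum mulr_suml.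
    under eq_bigr do rewrite corZ -scalerAl scalerAr -corZ.
    over.
  rewrite exchange_big /=; apply: eq_bigr => m _.
  by rewrite -mulr_sumr -cor_sum (newton_lagrange qP).
apply: int_alg_sum => m _.
have [s sP s1] := unit_splitn p_pr zetaP split1 m.
rewrite -[_^-1]mulr1 -s1 mulr_sumr scaler_suml cor_sum mulr_sumr big_seq.
apply: int_alg_sum => t /sP[t1 t2].
rewrite [_ * (t.1 * t.2)]mulrA -scalerA !corZ -scalerAr scalerAl.
apply: (int_algM SA); apply: cor_newton_mem => //.
rewrite -[- m%:Z](_ : - 2 * m%:Z + m%:Z = _).
  by apply: (idpowM p_pr zetaP) => //; apply: idpow_newton_topV.
by rewrite mulNr mulr_natl mulr2n opprD subrK.
Qed.

End Newton.

End Root.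
End Order.

(** * The antipode reverses products *)

Section TensorLemmas.
Variables (R : comNzRingType) (M N : lmodType R).

Lemma linear_tlift (V W : lmodType R) (L : V -> W) (f : M -> N -> V) (t : M ⊗ N) :
  linear L -> L (tlift f t) = tlift (fun a b => L (f a b)) t.
Proof.
move=> LL; pose L' : {linear V -> W} := HB.pack L (GRing.isLinear.Build _ _ _ _ L LL).
exact: (linear_sum L').
Qed.

Lemma tlift_param_linear (U V : lmodType R) (f : U -> M -> N -> V) (t : M ⊗ N) :
  (forall a b, linear (fun z => f z a b)) -> linear (fun z => tlift (f z) t).
Proof.
move=> fL c z z'; rewrite /tlift /evals scaler_sumr -big_split /=.
by apply: eq_bigr => ab _; apply: fL.
Qed.

Lemma eq_tlift (V : nmodType) (f g : M -> N -> V) (t : M ⊗ N) :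
  (forall a b, f a b = g a b) -> tlift f t = tlift g t.
Proof. by move=> fg; apply: eq_bigr => ab _; apply: fg. Qed.

Lemma exchange_tlift (M' N' : lmodType R) (V : nmodType)
    (f : M -> N -> M' -> N' -> V) (t : M ⊗ N) (u : M' ⊗ N') :
  tlift (fun a b => tlift (f a b) u) t = tlift (fun c d => tlift (fun a b => f a b c d) t) u.
Proof. exact: exchange_big. Qed.
End TensorLemmas.

Section Sweedler.
Variables (K : comNzRingType) (H : hopfAlgType K).
Implicit Types (x y : H).
Local Notation eps a := (counit a : K).
Local Notation S := (antipode : {linear H -> H}).

(** Coassociativity, tested on a trilinear map. *)
Lemma coassoc (V : lmodType K) (f : H -> H -> H -> V) x :
  (forall b c, linear (fun a => f a b c)) -> (forall a c, linear (fun b => f a b c)) ->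
  (forall a b, linear (f a b)) ->
  tlift (fun a b => tlift (fun c d => f c d b) (comul a)) (comul x) =
  tlift (fun a b => tlift (fun c d => f a c d) (comul b)) (comul x).
Proof.
move=> f1 f2 f3.
have fb a : bilin (f a) by split=> [c|b]; [apply: f2|apply: f3].
have gb : bilin (fun a (t : H ⊗ H) => tlift (f a) t).
  split=> [t|a]; last exact: tlift_linear.
  by apply: tlift_param_linear.
have GL := tlift_linear gb.
have := congr1 (tlift (fun a (t : H ⊗ H) => tlift (f a) t)) (comulA x).
have tb (z : H) : bilin (fun x y : H => x ⊗ (y ⊗ z)).
  split=> [y|a] c u v /=; first by rewrite tpureDl tpureZl.
  by rewrite tpureDl tpureZl tpureDr tpureZr.
have sb : bilin (fun (t : H ⊗ H) (z : H) => tlift (fun x y : H => x ⊗ (y ⊗ z)) t).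
  split=> [z|t]; first exact: tlift_linear.
  apply: tlift_param_linear => a b c u v /=.
  by rewrite !tpureDr !tpureZr.
rewrite /tassoc (linear_tlift _ _ (tlift_linear sb)) !(linear_tlift _ _ GL) => e.
transitivity (tlift (fun a b => tlift (fun a (t : H ⊗ H) => tlift (f a) t)
  (tlift (fun t z => tlift (fun x y => x ⊗ (y ⊗ z)) t) (comul a ⊗ b))) (comul x)).
  apply: eq_tlift => a b; rewrite (tlift_pure sb) (linear_tlift _ _ GL).
  by apply: eq_tlift => c d; rewrite (tlift_pure gb) tlift_pure.
by rewrite e; apply: eq_tlift => a b; rewrite (tlift_pure gb).
Qed.

Lemma tlift_comulM (V : lmodType K) (f : H -> H -> V) x y : bilin f ->
  tlift f (comul (x * y)) =
  tlift (fun a b => tlift (fun c d => f (a * c) (b * d)) (comul y)) (comul x).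
Proof.
move=> fb; rewrite rmorphM /= /GRing.mul /= /tmul (linear_tlift _ _ (tlift_linear fb)).
apply: eq_tlift => a b; rewrite (linear_tlift _ _ (tlift_linear fb)).
by apply: eq_tlift => c d; rewrite tlift_pure.
Qed.

(** Both sides are convolution inverses of the multiplication of H ⊗ H: in
    Sweedler notation, S(x1 y1) x2 y2 S(y3) S(x3) is evaluated in two ways. *)
Lemma antipodeM x y : S (x * y) = S y * S x.
Proof.
pose F a b1 b2 := tlift (fun c d => tlift (fun d1 d2 =>
  S (a * c) * (b1 * d1 * (S d2 * S b2))) (comul d)) (comul y).
transitivity (tlift (fun a b => tlift (F a) (comul b)) (comul x)).
  have Fe a b : tlift (F a) (comul b) = eps b *: S (a * y).
    have step b1 b2 : F a b1 b2 = S (a * y) * (b1 * S b2).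
      have h c d : tlift (fun d1 d2 => S (a * c) * (b1 * d1 * (S d2 * S b2))) (comul d)
          = S (a * (eps d *: c)) * (b1 * S b2).
        transitivity (tlift (fun d1 d2 => S (a * c) * (b1 * (d1 * S d2) * S b2)) (comul d)).
          by apply: eq_tlift => d1 d2; rewrite !mulrA.
        rewrite -(@linear_tlift _ _ _ _ _ (fun z => S (a * c) * (b1 * z * S b2))).
          by rewrite antipoder mulr_algr -!scalerAl -!scalerAr linearZ -scalerAl.
        by move=> k u v; rewrite mulrDr mulrDl mulrDr -!(scalerAl, scalerAr).
      rewrite /F (eq_tlift _ h) -(@linear_tlift _ _ _ _ _ (fun z => S (a * z) * (b1 * S b2))).
        by rewrite counitr.
      by move=> k u v; rewrite mulrDr linearD mulrDl -scalerAr linearZ -scalerAl.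
    rewrite (eq_tlift _ step) -(@linear_tlift _ _ _ _ _ (fun z => S (a * y) * z)).
      by rewrite antipoder mulr_algr.
    by move=> k u v; rewrite mulrDr -scalerAr.
  rewrite (eq_tlift _ Fe) -{1}[x]counitr.
  rewrite (@linear_tlift _ _ _ _ _ (fun z => S (z * y))).
    by apply: eq_tlift => a b; rewrite -scalerAl linearZ.
  by move=> k u v; rewrite mulrDl -scalerAl linearP.
have mulL (u v : H) : linear (fun z : H => u * z * v).
  by move=> k z z'; rewrite mulrDr mulrDl -scalerAr -scalerAl.
have SL (u v w : H) : linear (fun z : H => u * (v * (S z * w))).
  by move=> k z z'; rewrite linearP mulrDl !mulrDr -!(scalerAl, scalerAr).
have SR (u v w : H) : linear (fun z : H => u * (v * (w * S z))).
  by move=> k z z'; rewrite linearP !mulrDr -!scalerAr.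
have Sl (u v : H) : linear (fun z : H => S (z * u) * v).
  by move=> k z z'; rewrite mulrDl linearD mulrDl -scalerAl linearZ -scalerAl.
have Sr (u v : H) : linear (fun z : H => S (u * z) * v).
  by move=> k z z'; rewrite mulrDr linearD mulrDl -scalerAr linearZ -scalerAl.
have mr (u v w : H) : linear (fun z : H => u * (v * z * w)).
  by move=> k z z'; rewrite mulrDr mulrDl mulrDr -!(scalerAl, scalerAr).
have ml (u v w : H) : linear (fun z : H => u * (z * v * w)).
  by move=> k z z'; rewrite !mulrDl mulrDr -!(scalerAl, scalerAr).
rewrite -coassoc; first last.
- by move=> a b; do 2 apply: tlift_param_linear => ? ?; apply: SR.
- by move=> a c; do 2 apply: tlift_param_linear => ? ?; apply: ml.
- by move=> b c; do 2 apply: tlift_param_linear => ? ?; apply: Sl.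
have step a b : tlift (fun a1 a2 => F a1 a2 b) (comul a) = (counit a : K) *: (S y * S b).
  transitivity (tlift (fun a1 a2 => tlift (fun c d => tlift (fun c1 c2 =>
     S (a1 * c1) * (a2 * c2 * (S d * S b))) (comul c)) (comul y)) (comul a)).
    apply: eq_tlift => a1 a2; rewrite /F -(@coassoc _ (fun e1 e2 e3 => S (a1 * e1) * (a2 * e2 * (S e3 * S b)))) //.
  rewrite exchange_tlift.
  have h c d : tlift (fun a1 a2 => tlift (fun c1 c2 =>
     S (a1 * c1) * (a2 * c2 * (S d * S b))) (comul c)) (comul a)
     = (counit a : K) *: (S ((counit c : K) *: d) * S b).
    transitivity (tlift (fun a1 a2 => S a1 * a2) (comul (a * c)) * (S d * S b)).
      rewrite tlift_comulM; last first.
        split=> [u|u] k z z' /=; first by rewrite linearP mulrDl scalerAl.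
        by rewrite mulrDr scalerAr.
      have mL (u : H) : linear (fun z : H => z * u).
        by move=> k z z'; rewrite mulrDl scalerAl.
      rewrite (linear_tlift _ _ (mL _)); apply: eq_tlift => a1 a2.
      rewrite (linear_tlift _ _ (mL _)); apply: eq_tlift => c1 c2.
      by rewrite !mulrA.
    by rewrite antipodel rmorphM mulr_algl linearZ -scalerAl scalerA.
  rewrite (eq_tlift _ h) -(@linear_tlift _ _ _ _ _ (fun z => (counit a : K) *: (S z * S b))).
    by rewrite counitl.
  by move=> k u v; rewrite linearP mulrDl -scalerAl scalerDr !scalerA mulrC.
rewrite (eq_tlift _ step).
transitivity (tlift (fun a b => S y * S ((counit a : K) *: b)) (comul x)).
  by apply: eq_tlift => a b; rewrite linearZ -scalerAr.
rewrite -(@linear_tlift _ _ _ _ _ (fun z => S y * S z)) ?counitl //.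
by move=> k u v; rewrite linearP mulrDr -scalerAr.
Qed.

Lemma antipode1 : S 1 = 1.
Proof.
have := antipodel (1 : H); rewrite !rmorph1 scale1r.
have -> : (1 : H ⊗ H) = 1 ⊗ 1 by [].
rewrite tlift_pure ?mulr1 //.
split=> [u|u] k z z' /=; first by rewrite linearP mulrDl scalerAl.
by rewrite mulrDr scalerAr.
Qed.

Lemma antipodeX x n : S (x ^+ n) = S x ^+ n.
Proof.
by elim: n => [|n IHn]; rewrite ?antipode1 // exprS antipodeM IHn exprSr.
Qed.

End Sweedler.

(** * The algebra H ⊗ H *)

Section HopfTensor.
Variables (K : comNzRingType) (H : hopfAlgType K).

(** The map a ⊗ b |-> counit(a) b sends the coproduct 1 ⊗ 1 of 1 to 1. *)
Fact hopf_tensor_oner_neq0 : (1 : H ⊗ H) != 0.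
Proof.
apply/eqP => h; have := counitl (1 : H); rewrite rmorph1 h.
have cb : bilin (fun a b : H => (counit a : K) *: b).
  split=> [u|u] k z z' /=; first by rewrite linearP scalerDl scalerA.
  by rewrite scalerDr !scalerA mulrC.
by rewrite (tlift0 cb) => /eqP; rewrite eq_sym oner_eq0.
Qed.

HB.instance Definition _ :=
  GRing.PzSemiRing_isNonZero.Build (H ⊗ H)%type hopf_tensor_oner_neq0.

Fact tensor_scaleAl (c : K) (t u : H ⊗ H) : c *: (t * u) = c *: t * u.
Proof.
elim/tensor_ind: t => [|t1 t2 h1 h2|a b]; first by rewrite mul0r !scaler0 mul0r.
  by rewrite mulrDl !scalerDr h1 h2 mulrDl.
elim/tensor_ind: u => [|u1 u2 h1 h2|a' b']; first by rewrite !mulr0 scaler0.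
  by rewrite mulrDr !scalerDr h1 h2 mulrDr.
by rewrite -tpureZl /GRing.mul /= !tmul_pure -tpureZl scalerAl.
Qed.

Fact tensor_scaleAr (c : K) (t u : H ⊗ H) : c *: (t * u) = t * (c *: u).
Proof.
elim/tensor_ind: t => [|t1 t2 h1 h2|a b]; first by rewrite !mul0r !scaler0.
  by rewrite mulrDl !scalerDr h1 h2 mulrDl.
elim/tensor_ind: u => [|u1 u2 h1 h2|a' b']; first by rewrite !(mulr0, scaler0).
  by rewrite mulrDr !scalerDr h1 h2 mulrDr.
by rewrite -tpureZl /GRing.mul /= !tmul_pure -tpureZl scalerAr.
Qed.

HB.instance Definition _ := GRing.Lmodule_isLalgebra.Build K (H ⊗ H)%type tensor_scaleAl.
HB.instance Definition _ := GRing.Lalgebra_isAlgebra.Build K (H ⊗ H)%type tensor_scaleAr.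

Lemma tensorM (a b c d : H) : (a ⊗ b) * (c ⊗ d) = (a * c) ⊗ (b * d) :> H ⊗ H.
Proof. exact: tmul_pure. Qed.

Lemma tensorX (a b : H) n : (a ⊗ b) ^+ n = (a ^+ n) ⊗ (b ^+ n) :> H ⊗ H.
Proof. by elim: n => // n IHn; rewrite !exprS IHn tensorM. Qed.

End HopfTensor.

(** * Algebras given by generators and relations *)

Section FreeAlgebra.
Variables (K : fieldType) (G : choiceType) (A : algType K) (y : G -> A).
Local Notation F := {malg K[{fmonom G}]}.

Definition word_eval (m : {fmonom G}) : A := \prod_(i <- m) y i.

Fact word_eval_mmorphism : mmorphism word_eval.
Proof.
split; last by rewrite /word_eval fm1 big_nil.
by move=> a b; rewrite /word_eval fmM big_cat.
Qed.
HB.instance Definition _ :=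
  monalg.isMultiplicative.Build {fmonom G} A word_eval word_eval_mmorphism.

Definition free_eval : F -> A := mmap (in_alg A) word_eval.

Fact free_eval_linear : linear free_eval.
Proof.
move=> c u v; rewrite /free_eval mmapD; congr (_ + _).
by rewrite mmapZ mulr_algl.
Qed.

Fact free_eval_monoid : monoid_morphism free_eval.
Proof.
have [|h1 h2] := @commr_mmap_is_multiplicative {fmonom G} K A (in_alg A) word_eval.
  by move=> g m m'; rewrite /GRing.comm mulr_algl mulr_algr.
by split.
Qed.
HB.instance Definition _ := GRing.isLinear.Build K F A *:%R free_eval free_eval_linear.
HB.instance Definition _ := GRing.isMonoidMorphism.Build F A free_eval free_eval_monoid.

Lemma free_eval_gen i : free_eval (free_gen K i) = y i.
Proof. by rewrite /free_eval /free_gen mmapU /= scale1r mul1r /word_eval fmU big_seq1. Qed.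

(** A preimage in the free algebra is chosen for each element; the value does
    not depend on the choice since the relations hold in A. *)
Lemma presented_hom (H : algType K) (x : G -> H) (rels : seq (F * F)) :
  presented_by x rels ->
  (forall lr, lr \in rels -> free_eval lr.1 = free_eval lr.2) ->
  exists f : {lrmorphism H -> A}, forall i, f (x i) = y i.
Proof.
move=> [pi [pix piS piK]] relsP.
have ker w : pi w = 0 -> free_eval w = 0.
  move=> /piK[s sP ->]; rewrite linear_sum big_seq big1 // => t /sP/relsP e.
  by rewrite !rmorphM rmorphB /= e subrr mulr0 mul0r.
have ker2 w w' : pi w = pi w' -> free_eval w = free_eval w'.
  move=> e; have /= := ker (w - w'); rewrite !linearB /= e subrr => /(_ erefl) /eqP.
  by rewrite subr_eq0 => /eqP.
pose lift a := projT1 (cid (piS a)).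
have liftK a : pi (lift a) = a by rewrite /lift; case: cid.
pose f a := free_eval (lift a).
have fpi w : f (pi w) = free_eval w by apply: ker2; rewrite liftK.
have fl : linear f.
  by move=> c a b; rewrite -[a]liftK -[b]liftK -linearP !fpi linearP.
have fm : monoid_morphism f.
  split; first by rewrite -(rmorph1 pi) fpi rmorph1.
  by move=> a b; rewrite -[a]liftK -[b]liftK -rmorphM !fpi rmorphM.
pose f' : {lrmorphism H -> A} := HB.pack f (GRing.isLinear.Build K H A *:%R f fl)
  (GRing.isMonoidMorphism.Build H A f fm).
by exists f' => i; rewrite -pix /= fpi free_eval_gen.
Qed.

End FreeAlgebra.

Lemma presented_ind (K : fieldType) (G : choiceType) (H : algType K) (x : G -> H)
    (rels : seq ({malg K[{fmonom G}]} * {malg K[{fmonom G}]})) (P : H -> Prop) :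
  presented_by x rels ->
  P 1 -> (forall c a b, P a -> P b -> P (c *: a + b)) ->
  (forall i a, P a -> P (x i * a)) -> forall a, P a.
Proof.
move=> [pi [pix piS _]] P1 PL Px a; have [w <-] := piS a.
have P0 : P 0 by rewrite -(addNr 1) -scaleN1r; apply: PL.
have PD u v : P u -> P v -> P (u + v) by move=> Pu Pv; rewrite -[u]scale1r; apply: PL.
have PZ c u : P u -> P (c *: u) by move=> Pu; rewrite -[_ *: _]addr0; apply: PL.
have Pword (s : seq G) : P (pi (mkmalgU (FMonom s) 1)).
  elim: s => [|i s IHs].
    suff -> : mkmalgU (FMonom [::]) 1 = 1 :> {malg K[{fmonom G}]} by rewrite rmorph1.
    by rewrite -fmoneE.
  suff -> : mkmalgU (FMonom (i :: s)) 1 = free_gen K i * mkmalgU (FMonom s) 1 :> {malg K[{fmonom G}]}.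
    by rewrite rmorphM /= pix; apply: Px.
  rewrite /free_gen malgM_def fgmulUU mulr1; congr mkmalgU.
  by apply/eqP; rewrite fmP fmM fmU.
rewrite [w]monalgE linear_sum; elim/big_ind: _ => // m _.
have -> : << w@_m *g m >> = w@_m *: << m >> :> {malg K[{fmonom G}]}.
  by rewrite -mul_malgC malgM_def fgmulUU mul1m mulr1.
by rewrite linearZ; apply: PZ; rewrite -[m]fmK; apply: Pword.
Qed.

(** * The relations of Nikshych's algebra *)

Section Relations.
Variables (K : fieldType) (p : nat) (zeta : K).
Local Notation F := {malg K[{fmonom nik_gen}]}.

Record nik_relations (A : algType K) (y : nik_gen -> A) : Prop := NikRelations {
  rel_e0De1 : y E0 + y E1 = 1;
  rel_e0e1 : y E0 * y E1 = 0;
  rel_e1e0 : y E1 * y E0 = 0;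
  rel_uap : y Ua ^+ p = y E0;
  rel_ubp : y Ub ^+ p = y E0;
  rel_e0ua : y E0 * y Ua = y Ua;
  rel_e0ub : y E0 * y Ub = y Ub;
  rel_uaub : y Ua * y Ub = y Ub * y Ua;
  rel_vap : y Va ^+ p = y E1;
  rel_vbp : y Vb ^+ p = y E1;
  rel_e1va : y E1 * y Va = y Va;
  rel_e1vb : y E1 * y Vb = y Vb;
  rel_vavb : y Va * y Vb = zeta *: (y Vb * y Va);
  rel_gg : y Gg ^+ 2 = 1;
  rel_gua : y Gg * y Ua = y Ub * y Gg;
  rel_gub : y Gg * y Ub = y Ua * y Gg;
  rel_gva : y Gg * y Va = y Va * y Gg;
  rel_gvb : y Gg * y Vb = y Vb * y Gg }.

Lemma nik_relsP (A : algType K) (y : nik_gen -> A) (f : {lrmorphism F -> A}) :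
  (forall i, f (free_gen K i) = y i) ->
  nik_relations y <-> (forall lr, lr \in nik_rels p zeta -> f lr.1 = f lr.2).
Proof.
move=> fy.
have fM i j : f (free_gen K i * free_gen K j) = y i * y j by rewrite -(fy i) -(fy j); exact: (rmorphM f).
have fX i n : f (free_gen K i ^+ n) = y i ^+ n by rewrite -(fy i); exact: (rmorphXn f).
have fZ i j : f (zeta *: (free_gen K i * free_gen K j)) = zeta *: (y i * y j).
  by rewrite linearZ /= fM.
have f0 : f 0 = 0 := rmorph0 f.
have f1 : f 1 = 1 := rmorph1 f.
split=> [[r1 r2 r3 r4 r5 r6 r7 r8 r9 r10 r11 r12 r13 r14 r15 r16 r17 r18] lr|h].
  move=> lrP; rewrite -(nth_index (0, 0) lrP).
  have : (index lr (nik_rels p zeta) < 18)%N.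
    by rewrite -[18%N]/(size (nik_rels p zeta)) index_mem.
  move: (index lr _); move: lr lrP => _ _.
  case=> [_|]; first (rewrite /= rmorphD f1 /= !fy; exact r1).
  case=> [_|]; first (rewrite /= fM f0; exact r2).
  case=> [_|]; first (rewrite /= fM f0; exact r3).
  case=> [_|]; first (rewrite /= fX fy; exact r4).
  case=> [_|]; first (rewrite /= fX fy; exact r5).
  case=> [_|]; first (rewrite /= fM fy; exact r6).
  case=> [_|]; first (rewrite /= fM fy; exact r7).
  case=> [_|]; first exact: (etrans (fM _ _) (etrans r8 (esym (fM _ _)))).
  case=> [_|]; first (rewrite /= fX fy; exact r9).
  case=> [_|]; first (rewrite /= fX fy; exact r10).
  case=> [_|]; first (rewrite /= fM fy; exact r11).
  case=> [_|]; first (rewrite /= fM fy; exact r12).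
  case=> [_|]; first exact: (etrans (fM _ _) (etrans r13 (esym (fZ _ _)))).
  case=> [_|]; first (rewrite /= fX f1; exact r14).
  case=> [_|]; first exact: (etrans (fM _ _) (etrans r15 (esym (fM _ _)))).
  case=> [_|]; first exact: (etrans (fM _ _) (etrans r16 (esym (fM _ _)))).
  case=> [_|]; first exact: (etrans (fM _ _) (etrans r17 (esym (fM _ _)))).
  case=> [_|]; first exact: (etrans (fM _ _) (etrans r18 (esym (fM _ _)))).
  by [].
have e k (lk : (k < 18)%N) := h _ (mem_nth (0, 0) (lk : (k < size (nik_rels p zeta))%N)).
split.
- by have := e 0 isT; rewrite /= rmorphD f1 /= !fy.
- by have := e 1 isT; rewrite /= fM f0.
- by have := e 2 isT; rewrite /= fM f0.
- by have := e 3 isT; rewrite /= fX fy.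
- by have := e 4 isT; rewrite /= fX fy.
- by have := e 5 isT; rewrite /= fM fy.
- by have := e 6 isT; rewrite /= fM fy.
- exact: (etrans (esym (fM _ _)) (etrans (e 7 isT) (fM _ _))).
- by have := e 8 isT; rewrite /= fX fy.
- by have := e 9 isT; rewrite /= fX fy.
- by have := e 10 isT; rewrite /= fM fy.
- by have := e 11 isT; rewrite /= fM fy.
- exact: (etrans (esym (fM _ _)) (etrans (e 12 isT) (fZ _ _))).
- by have := e 13 isT; rewrite /= fX f1.
- exact: (etrans (esym (fM _ _)) (etrans (e 14 isT) (fM _ _))).
- exact: (etrans (esym (fM _ _)) (etrans (e 15 isT) (fM _ _))).
- exact: (etrans (esym (fM _ _)) (etrans (e 16 isT) (fM _ _))).
- exact: (etrans (esym (fM _ _)) (etrans (e 17 isT) (fM _ _))).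
Qed.

Variables (H : algType K) (x : nik_gen -> H).
Hypothesis xP : presented_by x (nik_rels p zeta).

Lemma presented_relations : nik_relations x.
Proof.
have [pi [pix _ piK]] := xP; apply/(nik_relsP pix) => lr lrP.
apply/eqP; rewrite -subr_eq0 -linearB; apply/eqP/piK.
exists [:: (1, lr, 1)]; first by move=> t; rewrite inE => /eqP->.
by rewrite big_seq1 /= mul1r mulr1.
Qed.

Lemma nik_hom (A : algType K) (y : nik_gen -> A) : nik_relations y ->
  exists f : {lrmorphism H -> A}, forall i, f (x i) = y i.
Proof. by move/(nik_relsP (free_eval_gen y)) => h; apply: (presented_hom xP h). Qed.

End Relations.

(** * Linear independence of the products of Newton polynomials *)

Section ClockShift.
Variables (K : fieldType) (n : nat).

(** The k-th vector of the standard basis, with k read modulo n + 1, so that the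
    shift matrix acts on these vectors by k |-> k + 1. *)
Definition wrow (k : nat) : 'rV[K]_n.+1 := delta_mx 0 (inord (k %% n.+1)).
Definition shiftm : 'M[K]_n.+1 := \matrix_(i < n.+1) wrow i.+1.
Definition diagm (d : nat -> K) : 'M[K]_n.+1 := \matrix_(i < n.+1) (d i *: wrow i).

Lemma wrow_mod j k : j = k %[mod n.+1] -> wrow j = wrow k.
Proof. by rewrite /wrow => ->. Qed.

Lemma wrow_row k (A : 'M[K]_n.+1) : wrow k *m A = row (inord (k %% n.+1)) A.
Proof. by rewrite rowE. Qed.

Lemma wrow_shift k : wrow k *m shiftm = wrow k.+1.
Proof.
rewrite wrow_row rowK inordK ?ltn_mod //; apply: wrow_mod.
by rewrite -[(_ %% _).+1]addn1 modnDml addn1.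
Qed.

Lemma wrow_diag k d : wrow k *m diagm d = d (k %% n.+1)%N *: wrow k.
Proof.
rewrite wrow_row rowK inordK ?ltn_mod //; congr (_ *: _).
by apply: wrow_mod; rewrite modn_mod.
Qed.

Lemma wrow_eq (A B : 'M[K]_n.+1) : (forall k, wrow k *m A = wrow k *m B) -> A = B.
Proof.
move=> AB; apply/row_matrixP => i; have := AB i.
by rewrite !wrow_row modn_small ?ltn_ord // inord_val.
Qed.

Lemma wrow_shiftX k j : wrow k *m shiftm ^+ j = wrow (k + j).
Proof.
elim: j => [|j IHj]; first by rewrite expr0 mulmx1 addn0.
by rewrite exprSr mulmxA IHj wrow_shift addnS.
Qed.

Lemma wrow_diagX k d j : wrow k *m diagm d ^+ j = d (k %% n.+1)%N ^+ j *: wrow k.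
Proof.
elim: j => [|j IHj]; first by rewrite !expr0 mulmx1 scale1r.
by rewrite exprSr mulmxA IHj -scalemxAl wrow_diag scalerA exprSr.
Qed.

Lemma shiftm_full : shiftm ^+ n.+1 = 1.
Proof.
apply: wrow_eq => k; rewrite wrow_shiftX mulmx1; apply: wrow_mod.
by rewrite modnDr.
Qed.

Lemma diagm_full d j : (forall k, d k ^+ j = 1) -> diagm d ^+ j = 1.
Proof. by move=> dj; apply: wrow_eq => k; rewrite wrow_diagX dj scale1r mulmx1. Qed.

Lemma row_cor (E a : 'M[K]_n.+1) (w : 'rV[K]_n.+1) c f :
  w *m E = w -> w *m a = c *: w -> w *m cor E a f = f.[c] *: w.
Proof.
move=> wE wa; rewrite /cor mulmxA wE.
elim/poly_ind: f => [|f b IHf]; first by rewrite rmorph0 mulmx0 horner0 scale0r.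
rewrite rmorphD rmorphM /= horner_algX horner_algC mulmxDr mulmxA IHf -scalemxAl wa.
by rewrite -scalemxAr mulmx1 scalerA -scalerDl !hornerE.
Qed.

Lemma col_cor (E a : 'M[K]_n.+1) (u : 'cV[K]_n.+1) c f :
  E *m u = u -> a *m u = c *: u -> cor E a f *m u = f.[c] *: u.
Proof.
move=> Eu au; rewrite /cor -mulmxA.
suff -> : horner_alg a f *m u = f.[c] *: u by rewrite -scalemxAr Eu.
elim/poly_ind: f => [|f b IHf]; first by rewrite rmorph0 mul0mx horner0 scale0r.
rewrite rmorphD rmorphM /= horner_algX horner_algC mulmxDl -mulmxA au -scalemxAr IHf.
by rewrite -scalemxAl mul1mx scalerA -scalerDl mulrC !hornerE mulrC.
Qed.

End ClockShift.

Lemma lrmorph_cor (K : fieldType) (A B : algType K) (f : {lrmorphism A -> B}) E a u :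
  f (cor E a u) = cor (f E) (f a) u.
Proof.
rewrite /cor rmorphM; congr (_ * _).
elim/poly_ind: u => [|u b IHu]; first by rewrite !rmorph0.
rewrite !rmorphD !rmorphM /= !horner_algX !horner_algC IHu.
by rewrite linearZ /= rmorph1.
Qed.

Section DualBasis.
Variables (K : fieldType) (p : nat) (zeta q : K).
Hypotheses (p_gt0 : (0 < p)%N) (qP : p.-primitive_root q) (zq : zeta * q = 1).
Hypothesis two_neq0 : 2%:R != 0 :> K.
Variables (H : algType K) (x : nik_gen -> H).
Hypothesis xP : presented_by x (nik_rels p zeta).
Local Notation N := (newton q).

(** The basis of H adapted to Y: chi selects the block e0 H or e1 H. *)
Definition pbw (chi eps : bool) m n : H :=
  (if chi then cor (x E1) (x Va) (N m) * cor (x E1) (x Vb) (N n)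
   else cor (x E0) (x Ua) (N m) * cor (x E0) (x Ub) (N n)) * x Gg ^+ eps.

Definition functional (f : H -> K) := forall c u v, f (c *: u + v) = c * f u + f v.

(** In this representation the first basis vector, acted upon from the right,
    is an eigenvector of ua and ub with eigenvalues q^i and q^j, and g
    exchanges the two basis vectors. *)
Definition rho_u i j (t : nik_gen) : 'M[K]_2 :=
  match t with
  | E0 => 1 | E1 => 0
  | Ua => diagm 1 (fun k => if k == 0%N then q ^+ i else q ^+ j)
  | Ub => diagm 1 (fun k => if k == 0%N then q ^+ j else q ^+ i)
  | Va => 0 | Vb => 0
  | Gg => shiftm K 1
  end.

Lemma rho_uP i j : nik_relations p zeta (rho_u i j).
Proof.
have q1 k : (q ^+ k) ^+ p = 1 by rewrite exprAC (prim_expr_order qP) expr1n.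
have zp : (0 : 'M[K]_2) ^+ p = 0 by rewrite expr0n eqn0Ngt p_gt0.
have odd2 k : (k.+1 %% 2 == 0)%N = ~~ (k %% 2 == 0)%N.
  by rewrite !modn2 /=; case: (odd k).
split; rewrite /rho_u ?(addr0, mul0r, mulr0, mul1r, scaler0) //.
- by apply: diagm_full => k; case: ifP.
- by apply: diagm_full => k; case: ifP.
- apply: wrow_eq => k; rewrite !mulmxA !wrow_diag -!scalemxAl !wrow_diag !scalerA.
  by rewrite mulrC.
- exact: shiftm_full.
- apply: wrow_eq => k; rewrite !mulmxA wrow_diag -!scalemxAl !wrow_shift wrow_diag odd2.
  by case: (_ == _).
- apply: wrow_eq => k; rewrite !mulmxA wrow_diag -!scalemxAl !wrow_shift wrow_diag odd2.
  by case: (_ == _).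
Qed.

(** The coordinate eps of the image of the first basis vector under [rho_u]. *)
Lemma eval_u eps i j : exists2 f, functional f & forall chi' eps' m n,
  f (pbw chi' eps' m n) =
    (if chi' then 0 else (eps == eps')%:R * ((N m).[q ^+ i] * (N n).[q ^+ j])).
Proof.
have [f fx] := nik_hom xP (rho_uP i j).
exists (fun h => (wrow K 1 0 *m f h) 0 (inord eps)).
  by move=> c u v; rewrite linearP mulmxDr -scalemxAr !mxE.
move=> chi' eps' m n; rewrite /pbw rmorphM rmorphXn /= fx.
case: chi'; rewrite rmorphM /= !lrmorph_cor !fx /=.
  by rewrite /cor !mul0r mulmx0 mxE.
rewrite 2!mulmxA (row_cor (c := q ^+ i) (w := wrow K 1 0)) ?mulmx1 ?wrow_diag //.
rewrite -!scalemxAl (row_cor (c := q ^+ j) (w := wrow K 1 0)) ?mulmx1 ?wrow_diag //.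
have dE : (wrow K 1 (0 + eps')) 0 (inord eps) = (eps == eps')%:R.
  by rewrite mxE eqxx -val_eqE /= !inordK //; case: (eps); case: (eps').
by rewrite -!scalemxAl wrow_shiftX mxE mxE dE mulrA mulrC.
Qed.

(** The clock and shift matrices, with g acting by the scalar s. *)
Definition rho_v n' (s : K) (t : nik_gen) : 'M[K]_n'.+1 :=
  match t with
  | E0 => 0 | E1 => 1
  | Ua => 0 | Ub => 0
  | Va => diagm n' (fun k => q ^+ k)
  | Vb => shiftm K n'
  | Gg => s%:A
  end.

Lemma rho_vP n' s : p = n'.+1 -> s ^+ 2 = 1 -> nik_relations p zeta (rho_v n' s).
Proof.
move=> pn s2.
have qmod k : q ^+ (k %% n'.+1) = q ^+ k by rewrite -pn (prim_expr_mod qP).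
have zp : (0 : 'M[K]_n'.+1) ^+ p = 0 by rewrite expr0n eqn0Ngt p_gt0.
split; rewrite /rho_v ?(add0r, mul0r, mulr0, mul1r, scaler0) //.
- by apply: diagm_full => k; rewrite exprAC (prim_expr_order qP) expr1n.
- by rewrite pn shiftm_full.
- apply: wrow_eq => k; rewrite -scalemxAr !mulmxA wrow_diag -!scalemxAl !wrow_shift wrow_diag.
  by rewrite scalerA !qmod exprS mulrA zq mul1r.
- by rewrite exprZn expr1n s2 scale1r.
- by rewrite mulr_algl mulr_algr.
- by rewrite mulr_algl mulr_algr.
Qed.

(** A row eigenvector of va and a column eigenvector of vb single out the value
    P_m(q^i) P_n(q^j), up to their pairing q^(ij), which is not 0; averaging
    over the two signs by which g may act selects the power of g. *)
Lemma eval_v eps i j : exists2 f, functional f & forall chi' eps' m n,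
  f (pbw chi' eps' m n) =
    (if chi' then (eps == eps')%:R * ((N m).[q ^+ i] * (N n).[q ^+ j]) else 0).
Proof.
have pn : p = p.-1.+1 by rewrite prednK.
have qmod k : q ^+ (k %% p.-1.+1) = q ^+ k by rewrite prednK // (prim_expr_mod qP).
have s1 : (1 : K) ^+ 2 = 1 by rewrite expr1n.
have s2 : (-1 : K) ^+ 2 = 1 by rewrite sqrrN expr1n.
have [f fx] := nik_hom xP (rho_vP pn s1).
have [f' fx'] := nik_hom xP (rho_vP pn s2).
pose u : 'cV[K]_p.-1.+1 := \col_k q ^+ (j * k).
have wu k : wrow K p.-1 k *m u = (q ^+ (j * k))%:M.
  rewrite [LHS]mx11_scalar; congr (_%:M); rewrite -rowE !mxE inordK ?ltn_mod //.
  by rewrite -qmod modnMmr qmod.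
have vu : shiftm K p.-1 *m u = q ^+ j *: u.
  apply/row_matrixP => k; rewrite !rowE -scalemxAr.
  have -> : delta_mx 0 k = wrow K p.-1 k by rewrite /wrow modn_small // inord_val.
  by rewrite mulmxA wrow_shift !wu scale_scalar_mx -exprD mulnS.
(* the sign that makes the two signs of g cancel unless eps' = eps *)
pose sg : K := (-1) ^+ eps.
pose ev (h : {lrmorphism H -> 'M[K]_p.-1.+1}) a := (wrow K p.-1 i *m h a *m u) 0 0.
have evl h c a b : ev h (c *: a + b) = c * ev h a + ev h b.
  by rewrite /ev linearP mulmxDr mulmxDl -scalemxAr -scalemxAl !mxE.
have evE (h : {lrmorphism H -> 'M[K]_p.-1.+1}) s : (forall t, h (x t) = rho_v p.-1 s t) -> forall chi' eps' m n,
  ev h (pbw chi' eps' m n) = if chi' then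
    s ^+ eps' * ((N m).[q ^+ i] * (N n).[q ^+ j] * q ^+ (j * i)) else 0.
  move=> hx chi' eps' m n; rewrite /ev /pbw rmorphM rmorphXn /= hx.
  case: chi'; rewrite rmorphM /= !lrmorph_cor !hx /=; last first.
    by rewrite /cor !mul0r mulmx0 mul0mx mxE.
  rewrite exprZn expr1n mulr_algr -scalemxAr -scalemxAl mxE; congr (_ * _).
  rewrite -[_ * _]/(_ *m _) mulmxA -(mulmxA _ (cor _ _ (N n)) u).
  rewrite (col_cor (c := q ^+ j)) ?mul1mx //.
  rewrite (row_cor (c := q ^+ i)) ?mulmx1 // ?wrow_diag ?qmod //.
  by rewrite -scalemxAr -scalemxAl wu !mxE eqxx mulr1n mulrCA mulrA.
exists (fun h => (ev f h + sg * ev f' h) / 2%:R / q ^+ (j * i)).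
  by move=> c a b; rewrite !evl; ring.
move=> chi' eps' m n; rewrite (evE _ _ fx) (evE _ _ fx'); case: chi'; last first.
  by rewrite mulr0 addr0 !mul0r.
have qn0 : q ^+ (j * i) != 0.
  by rewrite expf_neq0 // (prim_root_eq0 qP) -lt0n.
rewrite expr1n /sg; case: (eps); case: (eps') => /=; field; by rewrite ?qn0 ?two_neq0.
Qed.

(** The matrix of the P_m(q^i) is triangular with nonzero diagonal, so its
    inverse turns the evaluations [eval_u] and [eval_v] into coordinates. *)
Lemma dual_basis : exists d : bool -> bool -> 'I_p -> 'I_p -> H -> K,
  (forall chi eps m n, functional (d chi eps m n)) /\
  (forall chi eps (m n : 'I_p) chi' eps' (m' n' : 'I_p),
     d chi eps m n (pbw chi' eps' m' n') =
     [&& chi == chi', eps == eps', m == m' & n == n']%:R).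
Proof.
pose A : 'M[K]_p := \matrix_(i, m) (N m).[q ^+ i].
have Au : A \in unitmx.
  rewrite unitmxE det_trig; last first.
    by apply/is_trig_mxP => i m im; rewrite mxE newton_root.
  rewrite unitfE; apply/prodf_neq0 => i _; rewrite mxE; exact: (newton_top_neq0 qP (ltn_ord i)).
have ev chi eps i j : exists f, functional f /\ forall chi' eps' m n,
    f (pbw chi' eps' m n) = (chi == chi')%:R * ((eps == eps')%:R * ((N m).[q ^+ i] * (N n).[q ^+ j])).
  case: chi; [have [f fl fE] := eval_v eps i j|have [f fl fE] := eval_u eps i j];
    exists f; split=> // chi' eps' m n; rewrite fE; case: chi'; by rewrite ?mul1r ?mul0r.
pose F chi eps i j := projT1 (cid (ev chi eps i j)).
have FL chi eps i j c u v : F chi eps i j (c *: u + v) = c * F chi eps i j u + F chi eps i j v.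
  exact: (projT2 (cid (ev chi eps i j))).1.
have FE chi eps i j chi' eps' m n : F chi eps i j (pbw chi' eps' m n) =
    (chi == chi')%:R * ((eps == eps')%:R * ((N m).[q ^+ i] * (N n).[q ^+ j])).
  exact: (projT2 (cid (ev chi eps i j))).2.
pose B := invmx A.
exists (fun chi eps m n h => \sum_i \sum_j B m i * B n j * F chi eps i j h); split.
  move=> chi eps m n c u v; rewrite mulr_sumr -big_split; apply: eq_bigr => i _ /=.
  rewrite mulr_sumr -big_split; apply: eq_bigr => j _ /=.
  by rewrite FL mulrDr mulrCA.
move=> chi eps m n chi' eps' m' n'.
have BA (k l : 'I_p) : \sum_i B k i * (N l).[q ^+ i] = (k == l)%:R.
  have := congr1 (fun M : 'M[K]_p => M k l) (mulVmx Au); rewrite !mxE => <-.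
  by apply: eq_bigr => i _; rewrite mxE.
transitivity ((chi == chi')%:R * (eps == eps')%:R *
   ((\sum_i B m i * (N m').[q ^+ i]) * (\sum_j B n j * (N n').[q ^+ j]))).
  rewrite mulr_suml mulr_sumr; apply: eq_bigr => i _; rewrite mulr_sumr mulr_sumr.
  by apply: eq_bigr => j _; rewrite FE; ring.
by rewrite !BA; do 4 case: (_ == _); rewrite ?(mulr1, mulr0, mul0r).
Qed.

End DualBasis.

(** * Dual bases and extension of scalars *)

(** The dual basis lemma: e and phi express the identity of M through a free
    module of finite rank. *)
Section DualBasisModule.
Variables (R : comNzRingType) (M : lmodType R) (n : nat).
Variables (e : 'I_n -> M) (phi : 'I_n -> M -> R).
Hypothesis phi_linear : forall i c u v, phi i (c *: u + v) = c * phi i u + phi i v.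
Hypothesis ephi : forall y, y = \sum_i phi i y *: e i.

Lemma dual_basis_fg : finitely_generated M.
Proof.
pose s := [seq e i | i <- enum 'I_n]; exists s => y.
have szs : size s = n by rewrite size_map size_enum_ord.
exists (fun i => phi (cast_ord szs i) y); rewrite {1}[y]ephi.
rewrite (reindex (cast_ord szs)) /=; last first.
  by exists (cast_ord (esym szs)) => i _; rewrite ?cast_ordK ?cast_ordKV.
apply: eq_bigr => i _; congr (_ *: _).
rewrite (nth_map (cast_ord szs i)) ?size_enum_ord -?szs //; congr e.
by apply: val_inj; rewrite /= nth_enum_ord // -szs.
Qed.

Lemma dual_basis_projective : projective M.
Proof.
move=> N P f g fS; pose lift y := projT1 (cid (fS (g y))).
have liftK y : f (lift y) = g y by rewrite /lift; case: cid.
pose h y : N := \sum_i phi i y *: lift (e i).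
have hl : linear h.
  move=> c u v; rewrite /h scaler_sumr -big_split; apply: eq_bigr => i _ /=.
  by rewrite phi_linear scalerDl scalerA.
exists (HB.pack_for {linear M -> N} h (GRing.isLinear.Build R M N *:%R h hl)) => y /=.
rewrite /h linear_sum {2}[y]ephi linear_sum; apply: eq_bigr => i _.
by rewrite !linearZ liftK.
Qed.
End DualBasisModule.

Section BaseChange.
Variables (K : fieldExtType rat) (H : hopfAlgType K) (X : submodClosed (restr H)).
Local Notation R := (integers K).

Lemma base_change_bilin :
  bilin (fun (x : submodule X) (k : restr K^o) => (k : K) *: (val x : restr H) : restr H).
Proof.
split=> [k|x] c u v /=.
  change ((k : K) *: (val c *: (val u : H) + (val v : H)) =
    val c *: ((k : K) *: (val u : H)) + (k : K) *: (val v : H)).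
  by rewrite scalerDr !scalerA mulrC.
change ((val c * (u : K) + (v : K)) *: (val x : H) =
    val c *: ((u : K) *: (val x : H)) + (v : K) *: (val x : H)).
by rewrite scalerDl scalerA.
Qed.

Lemma base_change_pure (x : submodule X) (k : K) :
  base_change_map ((x ⊗ (k : restr K^o)) : submodule X ⊗ restr K^o) = k *: (val x : H).
Proof. exact: (tlift_pure base_change_bilin). Qed.

Lemma base_changeD (s t : submodule X ⊗ restr K^o) :
  base_change_map (s + t) = base_change_map s + base_change_map t.
Proof. exact: (tliftD base_change_bilin). Qed.

(** K is the fraction field of R, so a finite sum of pure tensors has a common
    denominator. *)
Lemma tensor_common_denom (t : submodule X ⊗ restr K^o) :
  exists (x : submodule X) (d : R), val d != 0 /\ t = x ⊗ ((val d)^-1 : restr K^o).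
Proof.
have mulden (x : submodule X) (k : K) (d : R) : val d != 0 ->
    x ⊗ (k : restr K^o) = (d *: x) ⊗ ((val d)^-1 * k : restr K^o).
  move=> d0; rewrite tpureZl -tpureZr; congr (x ⊗ _).
  by change (k = val d * ((val d)^-1 * k)); rewrite mulVKf.
elim/tensor_ind: t => [|t u [x [d [d0 ->]]] [y [b [b0 ->]]]|x k].
- exists 0, 1; split; first by rewrite rmorph1 oner_neq0.
  by rewrite (bilin0l (@tpure_bilin _ _ _)).
- exists (b *: x + d *: y), (d * b); split; first by rewrite rmorphM mulf_neq0.
  rewrite (mulden x _ b) // (mulden y _ d) // rmorphM invfM tpureDl; congr (_ + _).
  by rewrite mulrC.
have [d d0 dk] := integers_denom (k : K).
exists ((exist (fun z => z \in integers_pred K) _ dk : R) *: x), d; split=> //.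
rewrite tpureZl -tpureZr; congr (x ⊗ _).
change ((k : K) = val d * (k : K) * (val d)^-1).
by rewrite mulrAC mulfV // mul1r.
Qed.

Lemma base_change_bijective :
  (forall h : H, exists t, base_change_map (X := X) t = h) ->
  bijective (@base_change_map K H X).
Proof.
move=> bS; have bI : injective (@base_change_map K H X).
  move=> t u tu; apply/eqP; rewrite -subr_eq0; apply/eqP.
  have : base_change_map (t - u) = 0.
    by apply: (addIr (base_change_map u)); rewrite -base_changeD subrK add0r.
  have [x [d [d0 ->]]] := tensor_common_denom (t - u).
  rewrite base_change_pure => /eqP; rewrite scaler_eq0 invr_eq0 (negPf d0) /= => /eqP x0.
  have -> : x = 0 by apply: val_inj.
  by rewrite (bilin0l (@tpure_bilin _ _ _)).
exists (fun h => projT1 (cid (bS h))) => h; last by case: cid.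
by apply: bI; case: cid.
Qed.

End BaseChange.

(** * A lattice stable under the generators *)

Lemma prim_rootV (K : fieldType) p (z : K) : p.-primitive_root z -> p.-primitive_root z^-1.
Proof.
move=> zP; have p_gt0 := prim_order_gt0 zP.
have z0 : z != 0 by rewrite (prim_root_eq0 zP) -lt0n.
have -> : z^-1 = z ^+ p.-1.
  by apply: (mulfI z0); rewrite mulfV // -exprS prednK // (prim_expr_order zP).
by rewrite prim_root_exp_coprime // coprime_sym coprimenP.
Qed.

Lemma cor_intertwine (K : fieldType) (A : algType K) (y E F a b : A) f :
  y * E = F * y -> y * a = b * y -> y * cor E a f = cor F b f * y.
Proof.
move=> yE ya; rewrite /cor mulrA yE -!mulrA; congr (_ * _).
elim/poly_ind: f => [|f c IHf]; first by rewrite !rmorph0 mulr0 mul0r.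
rewrite !rmorphD !rmorphM /= !horner_algX !horner_algC mulrDr mulrDl.
by rewrite mulrA IHf -!mulrA ya mulr_algl mulr_algr.
Qed.

(** P_p = X^p - 1 vanishes at a and divides all later Newton polynomials. *)
Lemma cor_newton_ge (K : fieldType) (A : algType K) (E a : A) p (q : K) m :
  p.-primitive_root q -> E * E = E -> E * a = a -> a * E = a -> a ^+ p = E ->
  (p <= m)%N -> cor E a (newton q m) = 0.
Proof.
move=> qP EE Ea aE ap /subnK <-; elim: (m - p)%N => [|k IHk].
  by rewrite add0n (newton_full qP) linearB /= corXn cor1 ap EE subrr.
by rewrite addSn newtonS corM // IHk mul0r.
Qed.

(** Needed to move vb past P_m(va), as vb va = q va vb. The correction has degree
    one less, but its coefficient is in I^2. *)
Lemma newton_comp_scale (K : fieldType) (q : K) m :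
  newton q m \Po (q *: 'X) =
  q ^+ m *: newton q m + (q ^+ m.-1 * (q ^+ m - 1)) *: newton q m.-1.
Proof.
elim: m => [|m IHm].
  by rewrite newton0 -{1}polyC1 comp_polyC polyC1 expr0 subrr mulr0 scale0r addr0 scale1r.
rewrite newtonS comp_polyM IHm comp_polyB comp_polyX comp_polyC /=.
case: m {IHm} => [|m] /=.
  by rewrite !newton0 -!mul_polyC !expr0 expr1; ring.
by rewrite newtonS !exprS -!mul_polyC !(polyCM, polyCB); ring.
Qed.

Lemma cor_comp_scale (K : fieldType) (A : algType K) (E a : A) c f :
  cor E a (f \Po (c *: 'X)) = cor E (c *: a) f.
Proof.
rewrite /cor; congr (_ * _).
elim/poly_ind: f => [|f b IHf]; first by rewrite comp_poly0 !rmorph0.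
rewrite comp_polyD comp_polyM comp_polyX comp_polyC !rmorphD !rmorphM /= IHf.
by rewrite !horner_algX !horner_algC linearZ /= horner_algX mulr_algl.
Qed.

Section Lattice.
Variables (K : fieldExtType rat) (p : nat) (zeta : K).
Hypotheses (p_pr : prime p) (zetaP : p.-primitive_root zeta).
Variables (H : algType K) (x : nik_gen -> H).
Hypothesis rx : nik_relations p zeta x.
Local Notation idpow := (idpow zeta).
Local Notation O := (integers_pred K).
Local Notation q := (zeta^-1).
Local Notation N := (newton q).
Local Notation e0 := (x E0).
Local Notation e1 := (x E1).
Local Notation ua := (x Ua).
Local Notation ub := (x Ub).
Local Notation va := (x Va).
Local Notation vb := (x Vb).
Local Notation g := (x Gg).

Let p_gt0 := prime_gt0 p_pr.
Let qP := prim_rootV zetaP.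

Lemma zeta_neq0 : zeta != 0.
Proof. by rewrite (prim_root_eq0 zetaP) -lt0n. Qed.

Lemma e0e0 : e0 * e0 = e0.
Proof. by rewrite -[LHS]addr0 -(rel_e0e1 rx) -mulrDr (rel_e0De1 rx) mulr1. Qed.

Lemma e1e1 : e1 * e1 = e1.
Proof. by rewrite -[LHS]add0r -(rel_e1e0 rx) -mulrDr (rel_e0De1 rx) mulr1. Qed.

Lemma corner_unitr (E a : H) : E * a = a -> a ^+ p = E -> a * E = a.
Proof. by move=> Ea ap; rewrite -ap -exprS exprSr ap Ea. Qed.

Lemma uae0 : ua * e0 = ua. Proof. exact: corner_unitr (rel_e0ua rx) (rel_uap rx). Qed.
Lemma ube0 : ub * e0 = ub. Proof. exact: corner_unitr (rel_e0ub rx) (rel_ubp rx). Qed.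
Lemma vae1 : va * e1 = va. Proof. exact: corner_unitr (rel_e1va rx) (rel_vap rx). Qed.
Lemma vbe1 : vb * e1 = vb. Proof. exact: corner_unitr (rel_e1vb rx) (rel_vbp rx). Qed.

Lemma ge0 : g * e0 = e0 * g.
Proof.
rewrite -{1}(rel_uap rx) -(rel_ubp rx); elim: p => [|n IHn]; first by rewrite mulr1 mul1r.
by rewrite !exprS mulrA (rel_gua rx) -mulrA IHn mulrA.
Qed.

Lemma ge1 : g * e1 = e1 * g.
Proof.
have -> : e1 = 1 - e0 by rewrite -(rel_e0De1 rx) addrC addKr.
by rewrite mulrBr mulrBl ge0 mulr1 mul1r.
Qed.

Lemma vbva : vb * va = (q *: va) * vb.
Proof. by rewrite -scalerAl (rel_vavb rx) scalerA mulVf ?zeta_neq0 // scale1r. Qed.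

Local Notation U m := (cor e0 ua (N m)).
Local Notation U' m := (cor e0 ub (N m)).
Local Notation V m := (cor e1 va (N m)).
Local Notation V' m := (cor e1 vb (N m)).

Lemma mul_cor_newton (E a : H) m : E * E = E -> E * a = a -> a * E = a ->
  a * cor E a (N m) = cor E a (N m.+1) + q ^+ m *: cor E a (N m).
Proof.
move=> EE Ea aE; have {1}-> : a = cor E a 'X by rewrite corX.
rewrite -corM // -corZ -linearD /=; congr cor.
by rewrite newtonS mulrBr -mul_polyC mulrC [_ * (_ ^+ _)%:P]mulrC subrK.
Qed.

Lemma vb_newton m : vb * V m =
  (q ^+ m *: V m + (q ^+ m.-1 * (q ^+ m - 1)) *: V m.-1) * vb.
Proof.
rewrite (@cor_intertwine _ _ _ _ e1 _ (q *: va)) ?vbe1 ?(rel_e1vb rx) ?vbva //.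
by rewrite -cor_comp_scale newton_comp_scale linearD /= !corZ.
Qed.

Local Notation b := (pbw q x).

Lemma pbw_corner chi eps m n : (if chi then e1 else e0) * b chi eps m n = b chi eps m n.
Proof. by rewrite /pbw /cor; case: chi; rewrite !mulrA ?e0e0 ?e1e1. Qed.

Lemma e0_pbw chi eps m n : e0 * b chi eps m n = if chi then 0 else b chi eps m n.
Proof.
rewrite -{1}pbw_corner mulrA; case: chi; first by rewrite (rel_e0e1 rx) mul0r.
by rewrite e0e0; exact: (pbw_corner false).
Qed.

Lemma e1_pbw chi eps m n : e1 * b chi eps m n = if chi then b chi eps m n else 0.
Proof.
rewrite -{1}pbw_corner mulrA; case: chi; last by rewrite (rel_e1e0 rx) mul0r.
by rewrite e1e1; exact: (pbw_corner true).
Qed.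

Lemma UU'C m n : U m * U' n = U' n * U m.
Proof.
apply/esym/cor_intertwine.
  have /esym h := @cor_comm _ _ e0 ub (rel_e0ub rx) ube0 (N n).
  by rewrite /cor -mulrA h !mulrA e0e0 -h.
apply/esym/cor_intertwine; first by rewrite uae0 (rel_e0ua rx).
exact: (rel_uaub rx).
Qed.

Lemma g_pbw chi eps m n : g * b chi eps m n =
  if chi then b chi (~~ eps) m n else b chi (~~ eps) n m.
Proof.
have gX : g * g ^+ eps = g ^+ (~~ eps).
  by case: eps; rewrite ?mulr1 // -expr2 (rel_gg rx).
rewrite /pbw; case: chi.
  rewrite mulrA [g * _]mulrA (cor_intertwine (y := g) (F := e1) (b := va)) ?ge1 ?(rel_gva rx) //.
  rewrite -(mulrA (V m) g) (cor_intertwine (y := g) (F := e1) (b := vb)) ?ge1 ?(rel_gvb rx) //.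
  by rewrite -!mulrA gX.
rewrite mulrA [g * _]mulrA (cor_intertwine (y := g) (F := e0) (b := ub)) ?ge0 ?(rel_gua rx) //.
rewrite -(mulrA (U' m) g) (cor_intertwine (y := g) (F := e0) (b := ua)) ?ge0 ?(rel_gub rx) //.
by rewrite mulrA -UU'C -!mulrA gX.
Qed.

Lemma ua_pbw chi eps m n : (ua - e0) * b chi eps m n =
  if chi then 0 else b chi eps m.+1 n + (q ^+ m - 1) *: b chi eps m n.
Proof.
rewrite mulrBl e0_pbw; case: chi; first by rewrite -uae0 -mulrA e0_pbw mulr0 subrr.
rewrite /pbw 2!mulrA mul_cor_newton ?e0e0 ?(rel_e0ua rx) ?uae0 //.
by rewrite !mulrDl -!scalerAl -addrA -scaleN1r -scalerDl.
Qed.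

Lemma ub_pbw chi eps m n : (ub - e0) * b chi eps m n =
  if chi then 0 else b chi eps m n.+1 + (q ^+ n - 1) *: b chi eps m n.
Proof.
rewrite mulrBl e0_pbw; case: chi; first by rewrite -ube0 -mulrA e0_pbw mulr0 subrr.
rewrite /pbw !UU'C 2!mulrA mul_cor_newton ?e0e0 ?(rel_e0ub rx) ?ube0 //.
by rewrite !mulrDl -!scalerAl -addrA -scaleN1r -scalerDl.
Qed.

Lemma va_pbw chi eps m n : (va - e1) * b chi eps m n =
  if chi then b chi eps m.+1 n + (q ^+ m - 1) *: b chi eps m n else 0.
Proof.
rewrite mulrBl e1_pbw; case: chi; last by rewrite -vae1 -mulrA e1_pbw mulr0 subrr.
rewrite /pbw 2!mulrA mul_cor_newton ?e1e1 ?(rel_e1va rx) ?vae1 //.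
by rewrite !mulrDl -!scalerAl -addrA -scaleN1r -scalerDl.
Qed.

Lemma vb_pbw chi eps m n : (vb - e1) * b chi eps m n =
  let c := q ^+ m.-1 * (q ^+ m - 1) in
  if chi then q ^+ m *: b chi eps m n.+1 + (q ^+ (m + n) - 1) *: b chi eps m n
    + c *: b chi eps m.-1 n.+1 + (c * q ^+ n) *: b chi eps m.-1 n else 0.
Proof.
rewrite mulrBl e1_pbw /=; case: chi; last by rewrite -vbe1 -mulrA e1_pbw mulr0 subrr.
rewrite /pbw 2!mulrA vb_newton -(mulrA _ vb (V' n)).
move: (q ^+ m.-1 * _) => c.
rewrite mul_cor_newton ?e1e1 ?(rel_e1vb rx) ?vbe1 // !(mulrDl, mulrDr) -!(scalerAl, scalerAr).
rewrite !scalerA -exprD scalerBl scale1r -!addrA; congr (_ + (_ + _)).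
by rewrite addrA [RHS]addrC.
Qed.

(** The direct sum of the J^(m+n) times the basis elements of degrees m and n,
    in fact equal to Y. *)
Definition weight_bounded (z : H) : Prop :=
  exists2 c : bool * bool * 'I_p * 'I_p -> K,
    (forall t : bool * bool * 'I_p * 'I_p, idpow (- (t.1.2 + t.2)%:Z) (c t)) &
    z = \sum_t c t *: b t.1.1.1 t.1.1.2 t.1.2 t.2.

Lemma weight_boundedD y z : weight_bounded y -> weight_bounded z -> weight_bounded (y + z).
Proof.
move=> [c cP ->] [d dP ->]; exists (fun t => c t + d t) => [t|] /=.
  exact: idpowD.
by rewrite -big_split; apply: eq_bigr => t _; rewrite scalerDl.
Qed.

Lemma weight_boundedZ r z : r \in O -> weight_bounded z -> weight_bounded (r *: z).
Proof.
move=> rO [c cP ->]; exists (fun t => r * c t) => [t|] /=.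
  exact: (idpow_mull p_pr zetaP).
by rewrite scaler_sumr; apply: eq_bigr => t _; rewrite scalerA.
Qed.

Lemma weight_bounded0 : weight_bounded 0.
Proof.
exists (fun=> 0) => [t|] /=; first exact: idpow0.
by rewrite big1 // => t _; rewrite scale0r.
Qed.

Lemma pbw_ge_l chi eps m n : (p <= m)%N -> b chi eps m n = 0.
Proof.
move=> pm; rewrite /pbw; case: chi.
  rewrite (cor_newton_ge qP e1e1 (rel_e1va rx) vae1 (rel_vap rx) pm).
  by rewrite !mul0r.
rewrite (cor_newton_ge qP e0e0 (rel_e0ua rx) uae0 (rel_uap rx) pm).
by rewrite !mul0r.
Qed.

Lemma pbw_ge_r chi eps m n : (p <= n)%N -> b chi eps m n = 0.
Proof.
move=> pn; rewrite /pbw; case: chi.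
  rewrite (cor_newton_ge qP e1e1 (rel_e1vb rx) vbe1 (rel_vbp rx) pn).
  by rewrite mulr0 mul0r.
rewrite (cor_newton_ge qP e0e0 (rel_e0ub rx) ube0 (rel_ubp rx) pn).
by rewrite mulr0 mul0r.
Qed.

Lemma weight_bounded_pbw chi eps m n c :
  idpow (- (m + n)%:Z) c -> weight_bounded (c *: b chi eps m n).
Proof.
move=> hc; have [pm|mp] := leqP p m.
  by rewrite pbw_ge_l // scaler0; apply: weight_bounded0.
have [pn|np] := leqP p n.
  by rewrite pbw_ge_r // scaler0; apply: weight_bounded0.
pose t0 : bool * bool * 'I_p * 'I_p := (chi, eps, Ordinal mp, Ordinal np).
exists (fun t => if t == t0 then c else 0) => [t|] /=.
  by case: eqP => [->|_] //; apply: idpow0.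
rewrite (bigD1 t0) //= eqxx big1 ?addr0 // => t /negPf->.
by rewrite scale0r.
Qed.

Lemma weight_bounded_mul h : (forall chi eps m n c, idpow (- (m + n)%:Z) c ->
    weight_bounded (c *: (h * b chi eps m n))) ->
  forall z, weight_bounded z -> weight_bounded (h * z).
Proof.
move=> hb z [c cP ->]; rewrite mulr_sumr; elim/big_ind: _ => //.
- exact: weight_bounded0.
- exact: weight_boundedD.
by move=> t _; rewrite -scalerAr; apply: hb.
Qed.

Lemma weight_bounded_pbw_ge chi eps m n k c : - (m + n)%:Z <= k ->
  idpow k c -> weight_bounded (c *: b chi eps m n).
Proof. by move=> mnk kc; apply: weight_bounded_pbw; apply: (idpow_mono p_pr zetaP mnk). Qed.

Lemma weight_bounded_e0 z : weight_bounded z -> weight_bounded (e0 * z).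
Proof.
apply: weight_bounded_mul => chi eps m n c hc; rewrite e0_pbw.
by case: chi; [rewrite scaler0; apply: weight_bounded0|apply: weight_bounded_pbw].
Qed.

Lemma weight_bounded_e1 z : weight_bounded z -> weight_bounded (e1 * z).
Proof.
apply: weight_bounded_mul => chi eps m n c hc; rewrite e1_pbw.
by case: chi; [apply: weight_bounded_pbw|rewrite scaler0; apply: weight_bounded0].
Qed.

Lemma weight_bounded_g z : weight_bounded z -> weight_bounded (g * z).
Proof.
apply: weight_bounded_mul => chi eps m n c hc; rewrite g_pbw.
by case: chi; apply: weight_bounded_pbw; rewrite // addnC.
Qed.

Lemma weight_bounded_1 : weight_bounded 1.
Proof.
have e : b false false 0 0 + b true false 0 0 = 1.
  by rewrite /pbw !newton0 !cor1 e0e0 e1e1 !mulr1 (rel_e0De1 rx).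
rewrite -e -[b false _ _ _]scale1r -[b true _ _ _]scale1r.
by apply: weight_boundedD; apply: weight_bounded_pbw; rewrite idpow_int rpred1.
Qed.

Section NearMul.
Variable beta : K.
Hypothesis hbeta : idpow (-1) beta.

Lemma idpow_shift m n c : idpow (- (m + n)%:Z) c -> idpow (- (m + n).+1%:Z) (beta * c).
Proof.
by move=> hc; rewrite intS opprD; apply: (idpowM p_pr zetaP).
Qed.

Lemma idpow_shift_unity k m n c : idpow (- (m + n)%:Z) c ->
  idpow (- (m + n).-1%:Z) (beta * c * (q ^+ k - 1)).
Proof.
move=> hc; apply: (idpow_mono p_pr zetaP (l := - (m + n).+1%:Z + 2)); first by lia.
by apply: (idpowM p_pr zetaP); [apply: idpow_shift|apply: (idpow_rootB p_pr zetaP qP)].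
Qed.

Let wb_shift chi eps m n k l c : (k + l = (m + n).+1)%N -> idpow (- (m + n)%:Z) c ->
  weight_bounded ((beta * c) *: b chi eps k l).
Proof. by move=> e hc; apply: weight_bounded_pbw; rewrite e; apply: idpow_shift. Qed.

Let wb_unity chi eps m n k l j r c : ((m + n).-1 <= k + l)%N -> r \in O ->
  idpow (- (m + n)%:Z) c ->
  weight_bounded ((beta * c * (r * (q ^+ j - 1))) *: b chi eps k l).
Proof.
move=> e rO hc; apply: (@weight_bounded_pbw_ge _ _ _ _ (- (m + n).-1%:Z)); first by lia.
by rewrite mulrCA; apply: (idpow_mull p_pr zetaP) => //; apply: idpow_shift_unity.
Qed.

Let q_int : q \in O := root_integer p_pr zetaP qP.

Lemma weight_bounded_ua z : weight_bounded z -> weight_bounded ((beta *: (ua - e0)) * z).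
Proof.
apply: weight_bounded_mul => chi eps m n c hc; rewrite -scalerAl ua_pbw scalerA mulrC.
case: chi; first by rewrite scaler0; apply: weight_bounded0.
rewrite scalerDr scalerA; apply: weight_boundedD; first exact: wb_shift hc.
by rewrite -[_ - 1]mul1r; apply: wb_unity hc; rewrite ?rpred1 ?leq_pred.
Qed.

Lemma weight_bounded_ub z : weight_bounded z -> weight_bounded ((beta *: (ub - e0)) * z).
Proof.
apply: weight_bounded_mul => chi eps m n c hc; rewrite -scalerAl ub_pbw scalerA mulrC.
case: chi; first by rewrite scaler0; apply: weight_bounded0.
rewrite scalerDr scalerA; apply: weight_boundedD; first by apply: wb_shift hc; rewrite addnS.
by rewrite -[_ - 1]mul1r; apply: wb_unity hc; rewrite ?rpred1 ?leq_pred.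
Qed.

Lemma weight_bounded_va z : weight_bounded z -> weight_bounded ((beta *: (va - e1)) * z).
Proof.
apply: weight_bounded_mul => chi eps m n c hc; rewrite -scalerAl va_pbw scalerA mulrC.
case: chi; last by rewrite scaler0; apply: weight_bounded0.
rewrite scalerDr scalerA; apply: weight_boundedD; first exact: wb_shift hc.
by rewrite -[_ - 1]mul1r; apply: wb_unity hc; rewrite ?rpred1 ?leq_pred.
Qed.

(** Of the four terms of [vb_pbw], the last one loses a degree; multiplication
    by beta in J and by q^m - 1 in I^2 accounts exactly for that. *)
Lemma weight_bounded_vb z : weight_bounded z -> weight_bounded ((beta *: (vb - e1)) * z).
Proof.
apply: weight_bounded_mul => chi eps m n c hc; rewrite -scalerAl vb_pbw scalerA mulrC /=.
case: chi; last by rewrite scaler0; apply: weight_bounded0.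
rewrite !scalerDr !scalerA; do 3 ?apply: weight_boundedD.
- rewrite -mulrA [c * _]mulrC; apply: (@wb_shift _ _ m n); first by rewrite addnS.
  by apply: (idpow_mull p_pr zetaP); rewrite ?rpredX.
- by rewrite -[_ - 1]mul1r; apply: wb_unity hc; rewrite ?rpred1 ?leq_pred.
- case: m hc => [|m] hc; first by rewrite expr0 subrr !mulr0 scale0r; apply: weight_bounded0.
  by apply: wb_unity hc; rewrite ?rpredX //=; lia.
case: m hc => [|m] hc; first by rewrite expr0 subrr !(mulr0, mul0r) scale0r; apply: weight_bounded0.
rewrite (_ : _ * (_ * (_ - 1) * _) = beta * c * (q ^+ m * q ^+ n * (q ^+ m.+1 - 1))); last first.
  by rewrite -[_ * _ * q ^+ n]mulrA [_ * q ^+ n]mulrC !mulrA.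
by apply: wb_unity hc; rewrite ?rpredM ?rpredX //=; lia.
Qed.

End NearMul.

End Lattice.

(** * The order as a module *)

Section OrderY.
Variables (K : fieldExtType rat) (p : nat) (zeta : K).
Hypotheses (p_pr : prime p) (zetaP : p.-primitive_root zeta).
Variables (H : hopfAlgType K) (x : nik_gen -> H).
Hypothesis xP : presented_by x (nik_rels p zeta).
Variable I : submodClosed (integers K)^o.
Hypothesis hI : forall a : integers K,
  ideal_exp (fun b : integers K => b \in I) (2 * (p - 1)) a <-> principal_ideal p%:R a.
Local Notation idpow := (idpow zeta).
Local Notation O := (integers_pred K).
Local Notation q := (zeta^-1).
Local Notation N := (newton q).
Local Notation e0 := (x E0).
Local Notation e1 := (x E1).
Local Notation ua := (x Ua).
Local Notation ub := (x Ub).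
Local Notation va := (x Va).
Local Notation vb := (x Vb).
Local Notation g := (x Gg).
Local Notation Y := (orderY x I).
Local Notation inY := (fun h : H => (h : restr H) \in Y).

Let rx := presented_relations xP.
Let split1 : unit_split zeta 1 := unit_split1 p_pr zetaP hI.

Lemma inY_algebra : integral_algebra inY.
Proof.
split; [exact: rpred1|exact: rpredD|exact: rpredM|] => r h rO hY.
have /= := @rpredZ _ _ Y (exist (fun z => z \in O) _ rO : integers K) (h : restr H) hY.
by [].
Qed.

Lemma gen_inY (h : H) : order_gens x I h -> inY h.
Proof. by move=> hg; apply/asboolP => X _; apply. Qed.

Lemma e0_inY : inY e0. Proof. by apply: gen_inY; constructor 1. Qed.
Lemma e1_inY : inY e1. Proof. by apply: gen_inY; constructor 2. Qed.
Lemma g_inY : inY g. Proof. by apply: gen_inY; constructor 3. Qed.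

Lemma close_inY (h : H) : (forall alpha : K, inv_ideal I alpha ->
    [\/ alpha *: h = alpha *: (ua - e0), alpha *: h = alpha *: (ub - e0),
        alpha *: h = alpha *: (va - e1) | alpha *: h = alpha *: (vb - e1)]) ->
  forall b, idpow (-1) b -> inY (b *: h).
Proof.
move=> hh b hb; apply: gen_inY; constructor 4.
have bJ := idpow_inv_ideal p_pr zetaP hI hb.
by exists b => //; apply: hh.
Qed.

Lemma ua_close : close zeta inY e0 ua. Proof. by apply: close_inY => b _; constructor 1. Qed.
Lemma ub_close : close zeta inY e0 ub. Proof. by apply: close_inY => b _; constructor 2. Qed.
Lemma va_close : close zeta inY e1 va. Proof. by apply: close_inY => b _; constructor 3. Qed.
Lemma vb_close : close zeta inY e1 vb. Proof. by apply: close_inY => b _; constructor 4. Qed.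

Lemma orderY_ind (P : H -> Prop) : integral_algebra P -> P e0 -> P e1 -> P g ->
  close zeta P e0 ua -> close zeta P e0 ub -> close zeta P e1 va -> close zeta P e1 vb ->
  forall h : H, inY h -> P h.
Proof.
move=> [P1 PD PM PZ] P0 Pe1 Pg nua nub nva nvb h /asboolP hY.
pose X : {pred restr H} := fun h => `[< P h >].
have /asboolP // : h \in X.
apply: hY => [|s].
  split=> [|r y z /asboolP Py /asboolP Pz|y z /asboolP Py /asboolP Pz]; apply/asboolP => //.
    by apply: PD => //; apply: PZ => //; apply: integers_val.
  exact: PM.
case=> [->|->|->|[a /(inv_ideal_idpow p_pr zetaP hI) ha [->|->|->|->]]]; apply/asboolP => //.
- exact: nua.
- exact: nub.
- exact: nva.
- exact: nvb.
Qed.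

(** The lattice is stable under left multiplication by Y and contains 1. *)
Lemma orderY_weight_bounded h : inY h -> weight_bounded p zeta x h.
Proof.
move=> hY.
suff : forall z, weight_bounded p zeta x z -> weight_bounded p zeta x (h * z).
  by rewrite -[h in weight_bounded _ _ _ h]mulr1; apply; apply: weight_bounded_1.
apply: (orderY_ind (P := fun h => forall z, weight_bounded p zeta x z ->
  weight_bounded p zeta x (h * z))) hY => //.
- split=> [z|a b ha hb z hz|a b ha hb z hz|r a rO ha z hz]; first by rewrite mul1r.
  + by rewrite mulrDl; apply: weight_boundedD; auto.
  + by rewrite -mulrA; auto.
  + by rewrite -scalerAl; apply: weight_boundedZ; auto.
- by move=> z; apply: weight_bounded_e0.
- by move=> z; apply: weight_bounded_e1.
- by move=> z; apply: weight_bounded_g.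
- by move=> b hb z; apply: weight_bounded_ua.
- by move=> b hb z; apply: weight_bounded_ub.
- by move=> b hb z; apply: weight_bounded_va.
- by move=> b hb z; apply: weight_bounded_vb.
Qed.

(** The element c of J^(m+n) is a sum of products of an element of J^m and one
    of J^n, which are distributed over the two Newton polynomials. *)
Lemma pbw_inY chi eps m n c : idpow (- (m + n)%:Z) c -> inY (c *: pbw q x chi eps m n).
Proof.
have SA := inY_algebra.
have [s sP s1] := unit_splitn p_pr zetaP split1 n.
move=> hc; rewrite -[c]mulr1 -s1 mulr_sumr scaler_suml big_seq.
apply: (int_alg_sum SA) => t /sP[t1 t2]; rewrite mulrA -scalerA.
have ct : idpow (- m%:Z) (c * t.1).
  by rewrite -[- m%:Z](_ : - (m + n)%:Z + n = _) ?(idpowM p_pr zetaP) //; lia.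
have qP := prim_rootV zetaP.
have mem E a k d := @cor_newton_mem _ _ _ p_pr zetaP _ qP H _ SA split1 E a k d.
rewrite /pbw scalerAl scalerAl; apply: (int_algM SA); last first.
  by apply: (int_algX SA); exact: g_inY.
case: chi; rewrite scalerAr scalerAl; apply: (int_algM SA); apply: mem => //.
- exact: e1e1 rx.
- exact: rel_e1va rx.
- exact: vae1 rx.
- exact: e1_inY.
- exact: va_close.
- exact: e1e1 rx.
- exact: rel_e1vb rx.
- exact: vbe1 rx.
- exact: e1_inY.
- exact: vb_close.
- exact: e0e0 rx.
- exact: rel_e0ua rx.
- exact: uae0 rx.
- exact: e0_inY.
- exact: ua_close.
- exact: e0e0 rx.
- exact: rel_e0ub rx.
- exact: ube0 rx.
- exact: e0_inY.
- exact: ub_close.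
Qed.

Lemma gens_inY i : inY (x i).
Proof.
have SA := inY_algebra.
case: i.
- exact: e0_inY.
- exact: e1_inY.
- exact: (close_mem p_pr zetaP SA e0_inY ua_close).
- exact: (close_mem p_pr zetaP SA e0_inY ub_close).
- exact: (close_mem p_pr zetaP SA e1_inY va_close).
- exact: (close_mem p_pr zetaP SA e1_inY vb_close).
- exact: g_inY.
Qed.

Lemma orderY_denom (h : H) : exists2 d : K, d \in O /\ d != 0 & inY (d *: h).
Proof.
have [SA1 SAD SAM SAZ] := inY_algebra.
move: h; apply: (presented_ind xP).
- by exists 1; rewrite ?rpred1 ?oner_neq0 // scale1r.
- move=> c a b [d [dO d0] da] [d' [dO' d0'] db].
  have [k k0 kc] := integers_denom c.
  exists (val k * (d * d')); first by rewrite !rpredM ?integers_val ?mulf_neq0.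
  rewrite scalerDr scalerA; apply: SAD.
    rewrite (_ : _ * c = (val k * c) * d' * d); last by ring.
    by rewrite -scalerA; apply: SAZ => //; apply: rpredM kc dO'.
  rewrite (_ : val k * _ = val k * d * d') ?mulrA // -scalerA.
  by apply: SAZ; rewrite ?rpredM ?integers_val.
move=> i a [d dP da]; exists d => //.
by rewrite scalerAr; apply: SAM => //; apply: gens_inY.
Qed.

Lemma orderY_base_change : bijective (@base_change_map K H Y).
Proof.
apply: base_change_bijective => h; have [d [_ d0] dh] := orderY_denom h.
exists ((exist (fun z : restr H => z \in Y) (d *: h : H) dh : submodule Y) ⊗ (d^-1 : restr K^o)).
by rewrite base_change_pure /= scalerA mulVf // scale1r.
Qed.

(** If t has degrees m and n and k = m + n, write 1 as a sum of products
    gamma * beta with gamma in I^k and beta in J^k. The coordinate d_t of an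
    element of Y is in J^k, so the functionals gamma * d_t are integral on Y,
    and they are dual to the elements beta * pbw_t of Y. *)
Lemma orderY_dual_basis : exists n (e : 'I_n -> submodule Y) (phi : 'I_n -> submodule Y -> integers K),
  (forall i c u v, phi i (c *: u + v) = c * phi i u + phi i v) /\
  (forall y, y = \sum_i phi i y *: e i).
Proof.
have p_gt0 := prime_gt0 p_pr; have qP := prim_rootV zetaP.
have zq : zeta * q = 1 by rewrite mulfV // (zeta_neq0 p_pr zetaP).
have two0 : 2%:R != 0 :> K by rewrite natf_neq0_ext.
have [d [dL dE]] := dual_basis p_gt0 qP zq two0 xP.
pose T : finType := (bool * bool * 'I_p * 'I_p)%type.
pose bT (t : T) := pbw q x t.1.1.1 t.1.1.2 t.1.2 t.2.
pose dT (t : T) := d t.1.1.1 t.1.1.2 t.1.2 t.2.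
pose wt (t : T) := (t.1.2 + t.2)%N.
have dTL t (c : K) (u v : H) : dT t (c *: u + v) = c * dT t u + dT t v by apply: dL.
have dT0 t : dT t 0 = 0.
  have := dTL t 1 0 0; rewrite scaler0 addr0 mul1r => h.
  by apply: (addrI (dT t 0)); rewrite addr0 -h.
have coord (y : submodule Y) : (forall t, idpow (- (wt t)%:Z) (dT t (val y))) /\
    (val y : H) = \sum_t dT t (val y) *: bT t.
  have [c cP yE] := orderY_weight_bounded (valP y).
  suff dc t : dT t (val y) = c t.
    split=> [t|]; first by rewrite dc; apply: cP.
    by rewrite [LHS]yE; apply: eq_bigr => t _; rewrite dc.
  rewrite yE; transitivity (\sum_t' c t' * dT t (bT t')).
    elim/big_rec2: _ => [|t' u v _ <-]; first exact: dT0.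
    exact: dTL.
  rewrite (bigD1 t) //= big1 ?addr0.
    by rewrite /dT /bT dE !eqxx mulr1.
  move=> t' tt'; rewrite /dT /bT dE [X in _ * X](_ : _ = 0) ?mulr0 //.
  case: eqP => //= e1'; case: eqP => //= e2'; case: eqP => //= e3'; case: eqP => //= e4'.
  by case/negP: tt'; case: t t' e1' e2' e3' e4' => [[[? ?] ?] ?] [[[? ?] ?] ?] /= -> -> -> ->.
pose s t := projT1 (cid2 (unit_splitn p_pr zetaP split1 (wt t))).
have sP t gb : gb \in s t -> idpow (wt t) gb.1 /\ idpow (- (wt t)%:Z) gb.2.
  exact: (projT2 (cid2 (unit_splitn p_pr zetaP split1 (wt t)))).1.
have s1 t : \sum_(gb <- s t) gb.1 * gb.2 = 1.
  exact: (projT2 (cid2 (unit_splitn p_pr zetaP split1 (wt t)))).2.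
(* the index set: a basis element together with one term of a splitting of 1 *)
pose L := [seq (t, gb) | t <- enum T, gb <- s t].
have LP tgb : tgb \in L -> idpow (wt tgb.1) tgb.2.1 /\ idpow (- (wt tgb.1)%:Z) tgb.2.2.
  by case/allpairsPdep => t [gb [_ gbs ->]]; apply: sP.
pose e (l : T * (K * K)) : submodule Y := insubd (0 : submodule Y) ((l.2.2 *: bT l.1 : H) : restr H).
pose phi (l : T * (K * K)) (y : submodule Y) : integers K :=
  insubd (0 : integers K) (l.2.1 * dT l.1 (val y)).
have valE l : l \in L -> val (e l) = l.2.2 *: bT l.1.
  by case/LP => _ h; rewrite /e val_insubd pbw_inY.
have valphi l y : l \in L -> val (phi l y) = l.2.1 * dT l.1 (val y).
  case/LP => h _; rewrite /phi val_insubd -[_ \in _](idpow_int zeta).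
  have [hc _] := coord y.
  by have := idpowM p_pr zetaP h (hc l.1); rewrite subrr => ->.
pose l0 : T * (K * K) := ((true, true, Ordinal p_gt0, Ordinal p_gt0), (0, 0)).
exists (size L), (fun i => e (nth l0 L i)), (fun i => phi (nth l0 L i)); split.
  move=> i c u v; apply: val_inj; rewrite rmorphD rmorphM /= !valphi ?mem_nth //.
  have -> : val (c *: u + v) = val c *: (val u : H) + (val v : H) :> H by [].
  by rewrite dTL mulrDr mulrCA.
move=> y; apply: val_inj.
have [_ yE] := coord y.
rewrite [LHS]yE (linear_sum (val : {linear submodule Y -> restr H})) /=.
transitivity (\sum_(l <- L) (l.2.1 * dT l.1 (val y) * l.2.2) *: bT l.1 : H).
  rewrite /L big_allpairs_dep big_enum /=; apply: eq_bigr => t _.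
  rewrite -scaler_suml -[in LHS](mulr1 (dT t _)) -(s1 t) mulr_sumr; congr (_ *: _).
  by apply: eq_bigr => gb _; rewrite mulrCA mulrA.
rewrite (big_nth l0) big_mkord; apply: eq_bigr => i _.
have iL : nth l0 L i \in L by rewrite mem_nth.
rewrite -scalerA -(valphi _ y iL) -(valE _ iL) //.
Qed.

Lemma orderY_fg : finitely_generated (submodule Y).
Proof. by have [n [e [phi [pl pe]]]] := orderY_dual_basis; apply: (dual_basis_fg pe). Qed.

Lemma orderY_projective : projective (submodule Y).
Proof. by have [n [e [phi [pl pe]]]] := orderY_dual_basis; apply: (dual_basis_projective pl pe). Qed.

End OrderY.

(** * Products of three Fourier kernels *)

(** A geometric sum in q^-n X. *)
Lemma lagrange_eigen (K : fieldType) p (q : K) n : p.-primitive_root q ->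
  ('X - (q ^+ n)%:P) * lagrange_node p q n = (q ^+ n / p%:R) *: ('X^p - 1).
Proof.
move=> qP; have q0 : q != 0 by rewrite (prim_root_eq0 qP) -lt0n (prim_order_gt0 qP).
set z := q ^+ n; have z0 : z != 0 by rewrite expf_neq0.
have -> : lagrange_node p q n = p%:R^-1 *: \sum_(l < p) (z^-1 *: 'X) ^+ l.
  rewrite /lagrange_node; congr (_ *: _); apply: eq_bigr => l _.
  by rewrite exprZn -exprVn -exprM.
have -> : 'X - z%:P = z *: (z^-1 *: 'X - 1).
  by rewrite scalerBr scalerA mulfV // scale1r -alg_polyC.
rewrite -scalerAl -scalerAr -subrX1 scalerA exprZn.
have -> : z^-1 ^+ p = 1 by rewrite exprVn -exprM mulnC exprM (prim_expr_order qP) expr1n invr1.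
by rewrite scale1r.
Qed.

Section OrthogonalProducts.
Variables (A : nzRingType) (p : nat) (e : 'I_p -> A).
Hypothesis eO : forall m n, e m * e n = if m == n then e n else 0.

Lemma orthogonal_sum_mul (b c : 'I_p -> A) : (forall m n, b m * e n = e n * b m) ->
  (\sum_n e n * b n) * (\sum_n e n * c n) = \sum_n e n * (b n * c n).
Proof.
move=> be; rewrite mulr_suml; apply: eq_bigr => m _.
rewrite mulr_sumr (bigD1 m) //= big1 ?addr0 => [|n nm].
  by rewrite -mulrA [b m * _]mulrA be !mulrA eO eqxx.
by rewrite -mulrA [b m * _]mulrA be !mulrA eO eq_sym (negPf nm) !mul0r.
Qed.
End OrthogonalProducts.

Section TripleKernel.
Variables (K : fieldExtType rat) (p : nat) (zeta : K).
Hypotheses (p_pr : prime p) (zetaP : p.-primitive_root zeta).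
Variables (A : algType K) (S : A -> Prop).
Hypothesis SA : integral_algebra S.
Hypothesis split1 : unit_split zeta 1.
Variable w : K.
Hypothesis wP : p.-primitive_root w.
Local Notation closeS := (close zeta S).

Lemma kernel_mem_root E F a b : E * E = E -> E * a = a -> a * E = a ->
  F * F = F -> F * b = b -> b * F = b -> S E -> S F -> closeS E a -> closeS F b ->
  S (p%:R^-1 *: \sum_(k < p) \sum_(l < p) w ^+ (k * l) *: ((E * a ^+ k) * (F * b ^+ l))).
Proof.
have := @kernel_mem _ _ _ p_pr zetaP _ (prim_rootV wP) A S SA split1 E F a b.
by rewrite invrK.
Qed.

Variables (E a : A).
Hypotheses (EE : E * E = E) (Ea : E * a = a) (aE : a * E = a) (ap : a ^+ p = E).
Hypotheses (SE : S E) (na : closeS E a).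

Let e (n : 'I_p) := cor E a (lagrange_node p w^-1 n).

(** a acts on e n as the scalar w^-n, hence e m acts on it as the value of the
    m-th Lagrange polynomial at w^-n. *)
Lemma cor_lagrange_orth m n : e m * e n = if m == n then e n else 0.
Proof.
have wVP := prim_rootV wP.
have pn0 : p%:R != 0 :> K by rewrite natf_neq0_ext -lt0n prime_gt0.
set L := lagrange_node p w^-1 n.
have XL : cor E a ('X * L) = w^-1 ^+ n *: cor E a L.
  have := congr1 (cor E a) (lagrange_eigen n wVP).
  rewrite corZ [cor E a ('X^p - 1)]linearB /= corXn cor1 ap EE subrr scaler0.
  by rewrite mulrBl linearB /= mul_polyC corZ => /eqP; rewrite subr_eq0 => /eqP.
have ev f : cor E a (f * L) = f.[w^-1 ^+ n] *: cor E a L.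
  elim/poly_ind: f => [|f c IHf]; first by rewrite mul0r horner0 scale0r linear0.
  rewrite mulrDl -mulrA linearD /= mul_polyC corZ corM // XL -scalerAr -corM // IHf.
  by rewrite scalerA -scalerDl !hornerE mulrC.
rewrite /e -corM // -/L ev lagrange_nodeE // -val_eqE.
by case: (_ == _); rewrite ?scale1r ?scale0r.
Qed.

Lemma kernel_lagrange F b : \sum_n e n * (F * b ^+ n) =
  p%:R^-1 *: \sum_(k < p) \sum_(l < p) w ^+ (k * l) *: ((E * a ^+ k) * (F * b ^+ l)).
Proof.
rewrite exchange_big /= scaler_sumr; apply: eq_bigr => n _.
rewrite /e /lagrange_node corZ cor_sum -scalerAl mulr_suml; congr (_ *: _).
by apply: eq_bigr => k _; rewrite corZ corXn invrK -scalerAl mulnC.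
Qed.

(** As the e n are orthogonal idempotents that commute with b and c, this is the
    product of three kernels, namely the sums of the e n * b^n, of the
    e n * c^n and of the e n * d^n. *)
Lemma triple_kernel_mem b c d : 
  E * b = b -> b * E = b -> E * c = c -> c * E = c -> E * d = d -> d * E = d ->
  closeS E b -> closeS E c -> closeS E d -> a * b = b * a -> a * c = c * a ->
  S (p%:R^-1 *: \sum_(k < p) \sum_(n < p) w ^+ (k * n) *:
    ((E * a ^+ k) * ((E * b ^+ n) * (E * c ^+ n) * (E * d ^+ n)))).
Proof.
move=> Eb bE Ec cE Ed dE nb nc nd ab ac.
have comm y f : E * y = y -> y * E = y -> a * y = y * a -> forall m : nat,
    (E * y ^+ m) * cor E a f = cor E a f * (E * y ^+ m).
  move=> Ey yE ay m; apply: cor_intertwine.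
    by rewrite -mulrA -(commrX m (_ : GRing.comm E y)) // /GRing.comm Ey yE.
  by rewrite mulrA aE -mulrA -(commrX m (_ : GRing.comm a y)) // mulrA Ea.
have -> : p%:R^-1 *: \sum_(k < p) \sum_(n < p) w ^+ (k * n) *:
    ((E * a ^+ k) * ((E * b ^+ n) * (E * c ^+ n) * (E * d ^+ n))) =
    (\sum_n e n * (E * b ^+ n)) * (\sum_n e n * (E * c ^+ n)) * (\sum_n e n * (E * d ^+ n)).
  rewrite (orthogonal_sum_mul cor_lagrange_orth); last by move=> m n; apply: comm.
  rewrite (orthogonal_sum_mul cor_lagrange_orth); last first.
    move=> m n; rewrite /e -(mulrA (E * b ^+ m)) (comm c _ Ec cE ac m).
    by rewrite (mulrA (E * b ^+ m)) (comm b _ Eb bE ab m) -mulrA.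
  rewrite exchange_big /= scaler_sumr; apply: eq_bigr => n _.
  rewrite /e /lagrange_node corZ cor_sum -scalerAl mulr_suml; congr (_ *: _).
  by apply: eq_bigr => k _; rewrite corZ corXn invrK -scalerAl mulnC.
by do 2 ?apply: (int_algM SA); rewrite kernel_lagrange; apply: kernel_mem_root.
Qed.

End TripleKernel.

(** * The coproduct, counit and antipode on the order *)

Lemma orthogonal_expD (R : nzRingType) (u v : R) n : u * v = 0 -> v * u = 0 -> (0 < n)%N ->
  (u + v) ^+ n = u ^+ n + v ^+ n.
Proof.
move=> uv vu; case: n => // n _; elim: n => // n IHn.
have uv' : u * v ^+ n.+1 = 0 by rewrite exprS mulrA uv mul0r.
have vu' : v * u ^+ n.+1 = 0 by rewrite exprS mulrA vu mul0r.
by rewrite exprS IHn mulrDl !mulrDr uv' vu' -!exprS addr0 add0r.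
Qed.

Lemma idempotentX (R : nzRingType) (e : R) n : e * e = e -> e * e ^+ n = e.
Proof. by move=> ee; elim: n => [|n IHn]; rewrite ?mulr1 // exprS mulrA ee. Qed.

Lemma corner_expr_mod (R : nzRingType) (e a : R) p m : e * e = e -> a ^+ p = e ->
  e * a ^+ (m %% p) = e * a ^+ m.
Proof.
by move=> ee ap; rewrite [in RHS](divn_eq m p) exprD mulnC exprM ap mulrA idempotentX.
Qed.

Lemma corner_absr (R : nzRingType) (e a : R) n : e * e = e -> e * a = a -> a * e = a ->
  e * a ^+ n * e = e * a ^+ n.
Proof.
move=> ee ea ae; have ec : GRing.comm e (a ^+ n) by apply: commrX; rewrite /GRing.comm ea ae.
by rewrite -mulrA -ec mulrA ee.
Qed.

Lemma mul_double_sums (K : comNzRingType) (A : algType K) p (c d : K) (F G : 'I_p -> 'I_p -> A) :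
  (c *: \sum_j \sum_k F j k) * (d *: \sum_i \sum_l G i l) =
  (c * d) *: \sum_i \sum_j \sum_k \sum_l F j k * G i l.
Proof.
rewrite -scalerAl -scalerAr scalerA; congr (_ *: _).
rewrite [RHS]exchange_big /= mulr_suml; apply: eq_bigr => j _.
rewrite [RHS]exchange_big /= mulr_suml; apply: eq_bigr => k _.
rewrite mulr_sumr; apply: eq_bigr => i _.
by rewrite mulr_sumr.
Qed.

Lemma mul_scaled_sum (K : comNzRingType) (A : algType K) p (a : A) (c : K) (F : 'I_p -> 'I_p -> A) :
  a * (c *: \sum_i \sum_j F i j) = c *: \sum_i \sum_j a * F i j.
Proof.
rewrite -scalerAr mulr_sumr; congr (_ *: _).
by apply: eq_bigr => i _; rewrite mulr_sumr.
Qed.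

Section TensorOrder.
Variables (K : fieldExtType rat) (H : hopfAlgType K) (X : submodClosed (restr H)).
Variable zeta : K.
Local Notation inX := (fun h : H => (h : restr H) \in X).
Local Notation T := (H ⊗ H)%type.
Hypothesis XA : integral_algebra inX.

Definition in_tensor (t : T) : Prop := exists t', t = tensor_incl (X := X) t'.

Lemma tensor_incl_bilin :
  bilin (fun x y : submodule X => (val x : H) ⊗ (val y : H) : restr T).
Proof.
split=> [z|z] c u v /=.
  change (((val c : K) *: (val u : H) + val v) ⊗ (val z : H) =
    (val c : K) *: ((val u : H) ⊗ (val z : H)) + (val v : H) ⊗ (val z : H)).
  by rewrite tpureDl tpureZl.
change ((val z : H) ⊗ ((val c : K) *: (val u : H) + val v) =
    (val c : K) *: ((val z : H) ⊗ (val u : H)) + (val z : H) ⊗ (val v : H)).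
by rewrite tpureDr tpureZr.
Qed.

Lemma tensor_incl_pure (a b : submodule X) : tensor_incl (a ⊗ b) = (val a : H) ⊗ (val b : H).
Proof. exact: (tlift_pure tensor_incl_bilin). Qed.

Lemma tensor_inclD (s t : submodule X ⊗ submodule X) :
  tensor_incl (s + t) = tensor_incl s + tensor_incl t.
Proof. exact: (tliftD tensor_incl_bilin). Qed.

Lemma in_tensor_pure (a b : H) : inX a -> inX b -> in_tensor (a ⊗ b).
Proof.
move=> aX bX.
exists ((exist (fun z : restr H => z \in X) a aX : submodule X) ⊗
        (exist (fun z : restr H => z \in X) b bX : submodule X)).
by rewrite tensor_incl_pure.
Qed.

Lemma in_tensor_algebra : integral_algebra in_tensor.
Proof.
have D s t : in_tensor s -> in_tensor t -> in_tensor (s + t).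
  by move=> [s' ->] [t' ->]; exists (s' + t'); rewrite tensor_inclD.
have i0 : in_tensor 0 by exists 0; rewrite /tensor_incl (tlift0 tensor_incl_bilin).
split=> //.
- by apply: in_tensor_pure; apply: (int_alg1 XA).
- move=> _ _ [s ->] [t ->].
  elim/tensor_ind: s => [|s1 s2 h1 h2|a b].
  + by rewrite [tensor_incl 0](tlift0 tensor_incl_bilin) mul0r.
  + by rewrite tensor_inclD mulrDl; apply: D.
  elim/tensor_ind: t => [|t1 t2 h1 h2|c d].
  + by rewrite [tensor_incl 0](tlift0 tensor_incl_bilin) mulr0.
  + by rewrite tensor_inclD mulrDr; apply: D.
  rewrite !tensor_incl_pure tensorM.
  by apply: in_tensor_pure; apply: (int_algM XA); apply: valP.
move=> r t rO [t' ->]; exists ((exist (fun z => z \in integers_pred K) r rO : integers K) *: t').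
by rewrite /tensor_incl (tliftZ tensor_incl_bilin).
Qed.

(** From a ⊗ b - E ⊗ F = (a - E) ⊗ b + E ⊗ (b - F). *)
Lemma close_tensor p E F a b : prime p -> p.-primitive_root zeta -> inX E -> inX F ->
  close zeta inX E a -> close zeta inX F b -> close zeta in_tensor (E ⊗ F) (a ⊗ b).
Proof.
move=> p_pr zetaP EX FX na nb c hc.
have -> : c *: (a ⊗ b - E ⊗ F) = (c *: (a - E)) ⊗ b + E ⊗ (c *: (b - F)).
  rewrite tpureZl tpureZr -scalerDr (bilinDl (@tpure_bilin _ _ _)) (bilinNl (@tpure_bilin _ _ _)).
  by rewrite -[- F]scaleN1r tpureDr tpureZr scaleN1r addrA subrK.
apply: (int_algD in_tensor_algebra); apply: in_tensor_pure => //.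
- exact: na.
- exact: (close_mem p_pr zetaP XA FX nb).
- exact: nb.
Qed.

Lemma closeD E F a b : close zeta in_tensor E a -> close zeta in_tensor F b ->
  close zeta in_tensor (E + F) (a + b).
Proof.
move=> na nb c hc; rewrite opprD addrACA scalerDr.
by apply: (int_algD in_tensor_algebra); [apply: na|apply: nb].
Qed.

End TensorOrder.

Section Main.
Variables (K : fieldExtType rat) (p : nat) (zeta : K).
Hypotheses (p_pr : prime p) (zetaP : p.-primitive_root zeta).
Variables (H : hopfAlgType K) (x : nik_gen -> H).
Hypothesis nik : nikshych p zeta x.
Variable I : submodClosed (integers K)^o.
Hypothesis hI : forall a : integers K,
  ideal_exp (fun b : integers K => b \in I) (2 * (p - 1)) a <-> principal_ideal p%:R a.
Local Notation idpow := (idpow zeta).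
Local Notation O := (integers_pred K).
Local Notation q := (zeta^-1).
Local Notation e0 := (x E0).
Local Notation e1 := (x E1).
Local Notation ua := (x Ua).
Local Notation ub := (x Ub).
Local Notation va := (x Va).
Local Notation vb := (x Vb).
Local Notation g := (x Gg).
Local Notation Y := (orderY x I).
Local Notation inY := (fun h : H => (h : restr H) \in Y).
Local Notation T := (H ⊗ H)%type.

Let xP := nik_presented nik.
Let rx := presented_relations xP.
Let p_gt0 := prime_gt0 p_pr.
Let pp_gt0 : (0 < p - 1)%N. Proof. by rewrite subn_gt0 prime_gt1. Qed.
Let split1 : unit_split zeta 1 := unit_split1 p_pr zetaP hI.
Let YA : integral_algebra inY := inY_algebra x I.

Local Notation closeY := (close zeta inY).

Lemma counit_relE0 : (counit e0 : K) = 1.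
Proof. by rewrite -(rel_uap rx) rmorphXn /= (nik_counit_u nik).1 expr1n. Qed.

Lemma counit_relE1 : (counit e1 : K) = 0.
Proof. by rewrite -(rel_vap rx) rmorphXn /= (nik_counit_v nik).1 expr0n eqn0Ngt p_gt0. Qed.

Lemma orderY_counit (h : H) : inY h -> (counit h : K) \in O.
Proof.
have close0 (E a : H) : (counit a : K) = counit E ->
    close zeta (fun h : H => (counit h : K) \in O) E a.
  by move=> aE b _; rewrite linearZ linearB /= aE subrr scaler0 rpred0.
apply: (orderY_ind p_pr zetaP hI (P := fun h : H => (counit h : K) \in O)).
- split=> [|a b|a b|r a rO]; rewrite ?rmorph1 ?rpred1 // ?rmorphD ?rmorphM ?linearZ /=.
  + exact: rpredD.
  + exact: rpredM.
  + exact: rpredM.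
- by rewrite counit_relE0 rpred1.
- by rewrite counit_relE1 rpred0.
- by rewrite (nik_counit_g nik) rpred1.
- by apply: close0; rewrite counit_relE0 (nik_counit_u nik).1.
- by apply: close0; rewrite counit_relE0 (nik_counit_u nik).2.
- by apply: close0; rewrite counit_relE1 (nik_counit_v nik).1.
- by apply: close0; rewrite counit_relE1 (nik_counit_v nik).2.
Qed.

Lemma corner_pow_mul (E a : H) n : (0 < n)%N -> E * a = a -> E * a ^+ n = a ^+ n.
Proof. by case: n => // n _ Ea; rewrite exprS mulrA Ea. Qed.

Lemma close_pred (E a : H) : E * a = a -> inY E -> closeY E a -> closeY E (a ^+ (p - 1)).
Proof.
move=> Ea EY na; rewrite -(corner_pow_mul pp_gt0 Ea).
exact: (closeX p_pr zetaP YA).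
Qed.

Let e0Y := e0_inY x I.
Let e1Y := e1_inY x I.
Let uaN : closeY e0 ua := ua_close p_pr zetaP x hI.
Let ubN : closeY e0 ub := ub_close p_pr zetaP x hI.
Let vaN : closeY e1 va := va_close p_pr zetaP x hI.
Let vbN : closeY e1 vb := vb_close p_pr zetaP x hI.

Lemma antipode_e0 : antipode e0 = e0.
Proof.
rewrite -{1}(rel_uap rx) antipodeX (nik_antipode_u nik).1 exprAC (rel_uap rx).
by rewrite -(prednK pp_gt0) exprS idempotentX // (e0e0 rx).
Qed.

Lemma antipode_e1 : antipode e1 = e1.
Proof.
rewrite -{1}(rel_vap rx) antipodeX (nik_antipode_va nik) exprAC (rel_vap rx).
by rewrite -(prednK pp_gt0) exprS idempotentX // (e1e1 rx).
Qed.

Lemma orderY_antipode (h : H) : inY h -> inY (antipode h).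
Proof.
have closeS (E a : H) : antipode E = E -> closeY E (antipode a) ->
    close zeta (fun h : H => inY (antipode h)) E a.
  by move=> SE na b hb; rewrite linearZ linearB /= SE; apply: na.
apply: (orderY_ind p_pr zetaP hI (P := fun h : H => inY (antipode h))).
- split=> [|a b|a b ha hb|r a rO]; rewrite ?antipode1 ?linearD ?antipodeM ?linearZ /=.
  + exact: (int_alg1 YA).
  + exact: (int_algD YA).
  + exact: (int_algM YA).
  + exact: (int_algZ YA).
- by rewrite antipode_e0.
- by rewrite antipode_e1.
- by rewrite (nik_antipode_g nik); apply: g_inY.
- apply: closeS; rewrite ?antipode_e0 // (nik_antipode_u nik).1.
  by apply: close_pred => //; apply: (rel_e0ua rx).
- apply: closeS; rewrite ?antipode_e0 // (nik_antipode_u nik).2.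
  by apply: close_pred => //; apply: (rel_e0ub rx).
- apply: closeS; rewrite ?antipode_e1 // (nik_antipode_va nik).
  by apply: close_pred => //; apply: (rel_e1va rx).
- by apply: closeS; rewrite ?antipode_e1 // (nik_antipode_vb nik).
Qed.

Local Notation YY := (@in_tensor K H Y).
Let YYA : integral_algebra YY := in_tensor_algebra YA.
Local Notation closeT := (close zeta YY).
Let closeTP := @close_tensor _ H Y zeta YA p.

Lemma uava : ua * va = 0.
Proof. by rewrite -(uae0 rx) -(rel_e1va rx) -mulrA (mulrA e0) (rel_e0e1 rx) mul0r mulr0. Qed.

Lemma vaua : va * ua = 0.
Proof. by rewrite -(vae1 rx) -(rel_e0ua rx) -mulrA (mulrA e1) (rel_e1e0 rx) mul0r mulr0. Qed.

Lemma comul_e0 : comul e0 = e0 ⊗ e0 + e1 ⊗ e1.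
Proof.
rewrite -{1}(rel_uap rx) rmorphXn /= (nik_comul_ua nik).
rewrite orthogonal_expD // ?tensorM ?uava ?vaua; last first.
- exact: (bilin0l (@tpure_bilin _ _ _)).
- exact: (bilin0l (@tpure_bilin _ _ _)).
by rewrite !tensorX (rel_uap rx) (rel_vap rx).
Qed.

Lemma comul_e1 : comul e1 = e0 ⊗ e1 + e1 ⊗ e0.
Proof.
rewrite -{1}(rel_vap rx) rmorphXn /= (nik_comul_va nik).
rewrite orthogonal_expD // ?tensorM ?uava ?vaua; last first.
- exact: (bilin0l (@tpure_bilin _ _ _)).
- exact: (bilin0l (@tpure_bilin _ _ _)).
by rewrite !tensorX (rel_uap rx) (rel_vap rx).
Qed.

Local Notation U i := (e0 * ua ^+ i).
Local Notation U' i := (e0 * ub ^+ i).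
Local Notation V i := (e1 * va ^+ i).
Local Notation V' i := (e1 * vb ^+ i).

Lemma corner_powE (E a : H) n : E * a = a -> corner_pow E a n = E * a ^+ n.
Proof. by move=> Ea; case: n => [|n]; rewrite /corner_pow ?mulr1 // corner_pow_mul. Qed.

Lemma guE i j : gu x i j = g * (U i * U' j).
Proof. by rewrite /gu !corner_powE ?(rel_e0ua rx) ?(rel_e0ub rx) // mulrA. Qed.

Lemma gvE i j : gv x i j = g * (V i * V' j).
Proof. by rewrite /gv !corner_powE ?(rel_e1va rx) ?(rel_e1vb rx) // mulrA. Qed.

Let gg_in : YY (g ⊗ g).
Proof. by apply: in_tensor_pure; exact: g_inY. Qed.

Lemma pure_pow (E F a b : H) n : (E ⊗ F) * (a ⊗ b) ^+ n = (E * a ^+ n) ⊗ (F * b ^+ n).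
Proof. by rewrite tensorX tensorM. Qed.

Let ee0 := e0e0 rx.
Let ee1 := e1e1 rx.

(** The kernel of A = va ⊗ vb and B = vb ⊗ va^-1. Putting the second leg
    vb^k va^-l of A^k B^l in the order va^-l vb^k costs the factor zeta^(kl),
    which cancels the coefficient zeta^(-kl) of the kernel. *)
Lemma comul_g_term4 : YY (p%:R^-1 *: (\sum_(k < p) \sum_(l < p) gv x k l ⊗ gv x ((p - 1) * l) k)).
Proof.
have -> : p%:R^-1 *: (\sum_(k < p) \sum_(l < p) gv x k l ⊗ gv x ((p - 1) * l) k) =
  (g ⊗ g) * (p%:R^-1 *: \sum_(k < p) \sum_(l < p) q ^+ (k * l) *:
    (((e1 ⊗ e1) * (va ⊗ vb) ^+ k) * ((e1 ⊗ e1) * (vb ⊗ va ^+ (p - 1)) ^+ l))).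
  rewrite -scalerAr mulr_sumr; congr (_ *: _); apply: eq_bigr => k _.
  rewrite mulr_sumr; apply: eq_bigr => l _.
  rewrite !gvE -tensorM; congr (_ * _); rewrite !pure_pow tensorM -tpureZr; congr (_ ⊗ _).
  have comm j : vb ^+ k * va ^+ j = q ^+ (k * j) *: (va ^+ j * vb ^+ k).
    elim: (nat_of_ord k) => [|k' IHk]; first by rewrite mul1r mulr1 scale1r.
    have c1 : vb * va ^+ j = q ^+ j *: (va ^+ j * vb).
      elim: j {IHk} => [|j IHj]; first by rewrite mul1r mulr1 scale1r.
      rewrite exprS mulrA (vbva p_pr zetaP rx) -(mulrA _ vb) IHj -scalerAr -scalerAl scalerA.
      by rewrite -exprSr !mulrA.
    rewrite exprSr -(mulrA _ vb) c1 -scalerAr (mulrA (vb ^+ k')) IHk -scalerAl scalerA -(mulrA _ _ vb) -exprD.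
    by rewrite mulSn.
  have VC j : V' k * V j = q ^+ (k * j) *: (V j * V' k).
    have e1v a n : e1 * a = a -> a * e1 = a -> e1 * a ^+ n = a ^+ n * e1.
      by move=> ea ae; apply: commrX; rewrite /GRing.comm ea ae.
    rewrite -!mulrA (mulrA (vb ^+ k)) -(e1v vb) ?(rel_e1vb rx) ?(vbe1 rx) //.
    rewrite -(mulrA e1 (vb ^+ k)) comm (mulrA (va ^+ j) e1) -(e1v va) ?(rel_e1va rx) ?(vae1 rx) //.
    by rewrite -!scalerAr !mulrA ee1.
  rewrite -[va ^+ (p - 1) ^+ l]exprM VC scalerA -exprD.
  rewrite -mulnDr -mulSn (_ : (p - 1).+1 = p); last by rewrite subn1 prednK.
  by rewrite mulnCA [q ^+ (p * _)]exprM (prim_expr_order (prim_rootV zetaP)) expr1n scale1r.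
have vaP : e1 * va ^+ (p - 1) = va ^+ (p - 1) by rewrite corner_pow_mul ?(rel_e1va rx).
have Pva : va ^+ (p - 1) * e1 = va ^+ (p - 1).
  by rewrite -(prednK pp_gt0) exprSr -mulrA (vae1 rx).
apply: (int_algM YYA) => //.
apply: (kernel_mem_root p_pr zetaP YYA split1 (prim_rootV zetaP));
  rewrite ?tensorM ?ee1 ?(rel_e1va rx) ?(rel_e1vb rx) ?(vae1 rx) ?(vbe1 rx) ?vaP ?Pva //.
- exact: in_tensor_pure.
- exact: in_tensor_pure.
- exact: closeTP.
by apply: closeTP => //; apply: close_pred; rewrite ?(rel_e1va rx).
Qed.

Lemma uC i j : U i * U' j = U' j * U i.
Proof.
have e0u a n : e0 * a = a -> a * e0 = a -> GRing.comm e0 (a ^+ n).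
  by move=> ea ae; apply: commrX; rewrite /GRing.comm ea ae.
have c1 : GRing.comm (e0 * ua ^+ i) (e0 * ub ^+ j).
  apply: commrM; apply/commr_sym; apply: commrM => //.
  - by apply: e0u; rewrite ?(rel_e0ua rx) ?(uae0 rx).
  - by apply/commr_sym/e0u; rewrite ?(rel_e0ub rx) ?(ube0 rx).
  - by apply: commrX; apply/commr_sym; apply: commrX; apply: (rel_uaub rx).
exact: c1.
Qed.

(** Two kernels: the indices j, k belong to ub ⊗ e0 and e0 ⊗ ua, the indices
    i, l to ua ⊗ e0 and e0 ⊗ ub. *)
Lemma comul_g_term1 : YY ((p ^ 2)%:R^-1 *: (\sum_(i < p) \sum_(j < p) \sum_(k < p) \sum_(l < p)
       zeta ^ ((k * j)%:Z - (i * l)%:Z) *: (gu x i j ⊗ gu x k l))).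
Proof.
have -> : (p ^ 2)%:R^-1 *: (\sum_(i < p) \sum_(j < p) \sum_(k < p) \sum_(l < p)
       zeta ^ ((k * j)%:Z - (i * l)%:Z) *: (gu x i j ⊗ gu x k l)) =
  (g ⊗ g) * (
  (p%:R^-1 *: \sum_(j < p) \sum_(k < p) zeta ^+ (j * k) *:
    (((e0 ⊗ e0) * (ub ⊗ e0) ^+ j) * ((e0 ⊗ e0) * (e0 ⊗ ua) ^+ k))) *
  (p%:R^-1 *: \sum_(i < p) \sum_(l < p) q ^+ (i * l) *:
    (((e0 ⊗ e0) * (ua ⊗ e0) ^+ i) * ((e0 ⊗ e0) * (e0 ⊗ ub) ^+ l)))).
  rewrite mul_double_sums -scalerAr natrX -exprVn expr2; congr (_ *: _).
  rewrite mulr_sumr; apply: eq_bigr => i _.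
  rewrite mulr_sumr; apply: eq_bigr => j _.
  rewrite mulr_sumr; apply: eq_bigr => k _.
  rewrite mulr_sumr; apply: eq_bigr => l _.
  have z0 := zeta_neq0 p_pr zetaP.
  have -> : zeta ^ ((k * j)%:Z - (i * l)%:Z) = zeta ^+ (j * k) * q ^+ (i * l).
    by rewrite expfzDr // -exprnN -exprVn [(j * k)%N]mulnC.
  rewrite !guE -tensorM -scalerAl -!scalerAr scalerA; congr (_ *: _); congr (_ * _).
  rewrite !pure_pow !tensorM !idempotentX //; congr (_ ⊗ _).
    by rewrite (corner_absr _ ee0) ?(corner_absr _ ee0) ?(rel_e0ua rx) ?(uae0 rx) ?(rel_e0ub rx) ?(ube0 rx) // uC.
  by rewrite !(mulrA e0 e0) ee0.

apply: (int_algM YYA) => //; apply: (int_algM YYA).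
  apply: (kernel_mem_root p_pr zetaP YYA split1 zetaP);
    rewrite ?tensorM ?ee0 ?(rel_e0ua rx) ?(rel_e0ub rx) ?(uae0 rx) ?(ube0 rx) //.
  - exact: in_tensor_pure.
  - exact: in_tensor_pure.
  - by apply: closeTP => //; apply: (close_refl YA).
  - by apply: closeTP => //; apply: (close_refl YA).
apply: (kernel_mem_root p_pr zetaP YYA split1 (prim_rootV zetaP));
  rewrite ?tensorM ?ee0 ?(rel_e0ua rx) ?(rel_e0ub rx) ?(uae0 rx) ?(ube0 rx) //.
- exact: in_tensor_pure.
- exact: in_tensor_pure.
- by apply: closeTP => //; apply: (close_refl YA).
- by apply: closeTP => //; apply: (close_refl YA).
Qed.

Local Notation X := (ua * ub ^+ (p - 1)).

Let e0X : e0 * X = X. Proof. by rewrite mulrA (rel_e0ua rx). Qed.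
Let Xe0 : X * e0 = X.
Proof. by rewrite -mulrA -{1}(prednK pp_gt0) exprSr -mulrA (ube0 rx) -exprSr prednK. Qed.
Let uabX n : ua * ub ^+ n = ub ^+ n * ua. Proof. by apply: commrX; apply: (rel_uaub rx). Qed.
Let XX n : X ^+ n = ua ^+ n * ub ^+ ((p - 1) * n).
Proof. by rewrite exprMn_comm ?exprM //; apply: uabX. Qed.
Let Xp : X ^+ p = e0.
Proof.
rewrite XX mulnC exprM (rel_uap rx) (rel_ubp rx).
by rewrite idempotentX.
Qed.
Let XN : closeY e0 X.
Proof.
apply: (closeM p_pr zetaP YA) => //; first by rewrite corner_pow_mul ?(rel_e0ub rx).
by apply: close_pred; rewrite ?(rel_e0ub rx).
Qed.
Let Xub : X * ub = ub * X.
Proof. by rewrite -mulrA -exprSr exprS !mulrA (rel_uaub rx). Qed.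

(** The exponent p - 1 stands for -1, so that l is n - k for n = k + l. *)
Let U'mod k l : U' l = U' ((p - 1) * k + (k + l) %% p).
Proof.
rewrite -(corner_expr_mod _ ee0 (rel_ubp rx)) -[RHS](corner_expr_mod _ ee0 (rel_ubp rx)).
congr (_ * _ ^+ _); rewrite modnDmr addnA -mulSnr (_ : (p - 1).+1 = p) ?modnMDl //; last first.
  by rewrite subn1 prednK.
by rewrite mulnC modnMDl.
Qed.

Let shift (k : nat) (l : 'I_p) : 'I_p := Ordinal (ltn_pmod (k + l) p_gt0).
Let shift_inj k : injective (shift k).
Proof.
move=> l m /(congr1 val) /= /eqP; rewrite eqn_modDl !modn_small ?ltn_ord // => /eqP e.
exact: val_inj.
Qed.

(** X^k = ua^k ub^-k, with ub^(p - 1) for the inverse of ub in the corner. *)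
Let XU k n : (e0 * X ^+ k) * U' n = U k * U' ((p - 1) * k + n).
Proof.
have uc m : GRing.comm e0 (ub ^+ m) by apply: commrX; rewrite /GRing.comm (rel_e0ub rx) (ube0 rx).
rewrite XX (mulrA e0) -(mulrA (U k)) (mulrA (ub ^+ _) e0) -(uc ((p - 1) * k)%N).
by rewrite -(mulrA e0 (ub ^+ _)) -exprD.
Qed.

(** With n = k + l modulo p, the first leg ua^k ub^l is X^k ub^n, where X stands
    for ua ub^-1. This leaves a triple kernel in X ⊗ e1, with the factors
    ub ⊗ e1, e0 ⊗ va and e0 ⊗ vb. *)
Lemma comul_g_term2 : YY (p%:R^-1 *: (\sum_(k < p) \sum_(l < p)
       zeta ^ (- ((k + l) * k)%:Z) *: (gu x k l ⊗ gv x (k + l) (k + l)))).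
Proof.
have -> : p%:R^-1 *: (\sum_(k < p) \sum_(l < p)
       zeta ^ (- ((k + l) * k)%:Z) *: (gu x k l ⊗ gv x (k + l) (k + l))) =
  (g ⊗ g) * (p%:R^-1 *: \sum_(k < p) \sum_(n < p) q ^+ (k * n) *:
    (((e0 ⊗ e1) * (X ⊗ e1) ^+ k) * (((e0 ⊗ e1) * (ub ⊗ e1) ^+ n) *
       ((e0 ⊗ e1) * (e0 ⊗ va) ^+ n) * ((e0 ⊗ e1) * (e0 ⊗ vb) ^+ n)))).
  rewrite mul_scaled_sum; congr (_ *: _); apply: eq_bigr => k _.
  rewrite [RHS](reindex_inj (@shift_inj k)); apply: eq_bigr => l _ /=.
  rewrite -exprnN -exprVn mulnC exprM -(prim_expr_mod (prim_rootV zetaP) (k * ((k + l) %% p))).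
  rewrite modnMmr (prim_expr_mod (prim_rootV zetaP)) -exprM.
  rewrite -scalerAr; congr (_ *: _).
  rewrite guE gvE -tensorM; congr (_ * _).
  rewrite !pure_pow !tensorM !idempotentX //; congr (_ ⊗ _).
    rewrite (corner_absr _ ee0) ?(rel_e0ub rx) ?(ube0 rx) //.
    by rewrite (corner_absr _ ee0) ?(rel_e0ub rx) ?(ube0 rx) // XU -U'mod.
  by rewrite (mulrA e1 e1) ee1 (mulrA e1 (V _)) (mulrA e1 e1) ee1 !(corner_expr_mod _ ee1) ?(rel_vap rx) ?(rel_vbp rx).
apply: (int_algM YYA) => //.
apply: (triple_kernel_mem p_pr zetaP YYA split1 (prim_rootV zetaP));
  rewrite ?tensorX ?tensorM ?ee0 ?ee1 ?e0X ?Xe0 ?(rel_e0ub rx) ?(rel_e1va rx) ?(rel_e1vb rx)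
   ?(ube0 rx) ?(vae1 rx) ?(vbe1 rx) //.
- by rewrite Xp -(prednK p_gt0) exprS idempotentX.
- exact: in_tensor_pure.
- by apply: closeTP => //; apply: (close_refl YA).
- by apply: closeTP => //; apply: (close_refl YA).
- by apply: closeTP => //; apply: (close_refl YA).
- by apply: closeTP => //; apply: (close_refl YA).
- by rewrite Xub.
Qed.

(** As for [comul_g_term2], with X in the second leg and vb^-1 in place of vb. *)
Lemma comul_g_term3 : YY (p%:R^-1 *: (\sum_(k < p) \sum_(l < p)
       zeta ^ (k * (k + l))%:Z *: (gv x (k + l) ((p - 1) * (k + l)) ⊗ gu x k l))).
Proof.
have vP : e1 * vb ^+ (p - 1) = vb ^+ (p - 1) by rewrite corner_pow_mul ?(rel_e1vb rx).
have Pv : vb ^+ (p - 1) * e1 = vb ^+ (p - 1).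
  by rewrite -(prednK pp_gt0) exprSr -mulrA (vbe1 rx).
have vPp : (vb ^+ (p - 1)) ^+ p = e1.
  by rewrite exprAC (rel_vbp rx) -(prednK pp_gt0) exprS idempotentX.
have -> : p%:R^-1 *: (\sum_(k < p) \sum_(l < p)
       zeta ^ (k * (k + l))%:Z *: (gv x (k + l) ((p - 1) * (k + l)) ⊗ gu x k l)) =
  (g ⊗ g) * (p%:R^-1 *: \sum_(k < p) \sum_(n < p) zeta ^+ (k * n) *:
    (((e1 ⊗ e0) * (e1 ⊗ X) ^+ k) * (((e1 ⊗ e0) * (va ⊗ e0) ^+ n) *
       ((e1 ⊗ e0) * (vb ^+ (p - 1) ⊗ e0) ^+ n) * ((e1 ⊗ e0) * (e1 ⊗ ub) ^+ n)))).
  rewrite mul_scaled_sum; congr (_ *: _); apply: eq_bigr => k _.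
  rewrite [RHS](reindex_inj (@shift_inj k)); apply: eq_bigr => l _ /=.
  rewrite -exprnP -(prim_expr_mod zetaP (k * ((k + l) %% p))).
  rewrite modnMmr (prim_expr_mod zetaP) -scalerAr; congr (_ *: _).
  rewrite guE gvE -tensorM; congr (_ * _).
  rewrite !pure_pow !tensorM !idempotentX //; congr (_ ⊗ _); last first.
    by rewrite ee0 (mulrA e0 e0) ee0 XU -U'mod.
  rewrite (corner_expr_mod _ ee1 (rel_vap rx)) (corner_expr_mod _ ee1 vPp) -exprM.
  rewrite -(mulrA (V _)) (corner_absr _ ee1) ?(rel_e1vb rx) ?(vbe1 rx) //.
  by rewrite !mulrA ee1.
apply: (int_algM YYA) => //.
apply: (triple_kernel_mem p_pr zetaP YYA split1 zetaP);
  rewrite ?tensorX ?tensorM ?ee0 ?ee1 ?e0X ?Xe0 ?(rel_e0ub rx) ?(rel_e1va rx) ?vP ?Pv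
   ?(ube0 rx) ?(vae1 rx) //.
- by rewrite Xp -(prednK p_gt0) exprS idempotentX.
- exact: in_tensor_pure.
- by apply: closeTP => //; apply: (close_refl YA).
- by apply: closeTP => //; apply: (close_refl YA).
- apply: closeTP => //; last exact: (close_refl YA).
  by apply: close_pred; rewrite ?(rel_e1vb rx).
- by apply: closeTP => //; apply: (close_refl YA).
Qed.

Lemma orderY_comul (h : H) : inY h -> YY (comul h).
Proof.
have closeC (E a : H) (E' a' : T) : comul E = E' -> comul a = a' -> closeT E' a' ->
    close zeta (fun h : H => YY (comul h)) E a.
  by move=> <- <- na b hb; rewrite linearZ linearB /=; apply: na.
apply: (orderY_ind p_pr zetaP hI (P := fun h : H => YY (comul h))).
- split=> [|a b ha hb|a b ha hb|r a rO ha].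
  + by rewrite rmorph1; apply: (int_alg1 YYA).
  + by rewrite rmorphD; apply: (int_algD YYA).
  + by rewrite rmorphM; apply: (int_algM YYA).
  + by rewrite linearZ; apply: (int_algZ YYA).
- by rewrite comul_e0; apply: (int_algD YYA); apply: in_tensor_pure.
- by rewrite comul_e1; apply: (int_algD YYA); apply: in_tensor_pure.
- rewrite (nik_comul_gE nik) /nik_comul_g; do 3 ?apply: (int_algD YYA).
  + exact: comul_g_term1.
  + exact: comul_g_term2.
  + exact: comul_g_term3.
  + exact: comul_g_term4.
- apply: (closeC _ _ _ _ comul_e0 (nik_comul_ua nik)).
  by apply: closeD => //; apply: closeTP.
- apply: (closeC _ _ _ _ comul_e0 (nik_comul_ub nik)); apply: closeD => //; apply: closeTP => //.
  by apply: close_pred; rewrite ?(rel_e1vb rx).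
- apply: (closeC _ _ _ _ comul_e1 (nik_comul_va nik)).
  by apply: closeD => //; apply: closeTP.
- apply: (closeC _ _ _ _ comul_e1 (nik_comul_vb nik)); apply: closeD => //; apply: closeTP => //.
  by apply: close_pred; rewrite ?(rel_e0ub rx).
Qed.

End Main.

Theorem theorem5p11 (p : nat) (K : fieldExtType rat) (zeta : K)
    (H : hopfAlgType K) (x : nik_gen -> H) (I : submodClosed (integers K)^o) :
  prime p -> odd p -> p.-primitive_root zeta ->
  nikshych p zeta x ->
  (forall a : integers K,
     ideal_exp (fun b : integers K => b \in I) (2 * (p - 1)) a <-> principal_ideal p%:R a) ->
  hopf_order (orderY x I).
Proof.
move=> p_pr _ zetaP nik hI; have xP := nik_presented nik.
split.
- exact: (orderY_fg p_pr zetaP xP hI).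
- exact: (orderY_projective p_pr zetaP xP hI).
- exact: (orderY_base_change p_pr zetaP xP hI).
- exact: rpred1.
- by move=> a b; apply: rpredM.
- exact: (orderY_comul p_pr zetaP nik hI).
- exact: (orderY_counit p_pr zetaP nik hI).
- exact: (orderY_antipode p_pr zetaP nik hI).
Qed.
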